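(* Let $K$ be a field, let $X\subseteq \mathbb{P}^{n_1}\times\cdots\times\mathbb{P}^{n_r}$ and $Y\subseteq\mathbb{P}^{m_1}\times\cdots\times\mathbb{P}^{m_s}$ be absolutely irreducible multi-projective varieties over $K$ with homogeneous coordinate rings $R/I$ and $S/J$, and let $\Phi:X\dashrightarrow Y$ be a birational (multi-rational) map. Let $\Psi=(\Psi_1,\ldots,\Psi_r):Y\dashrightarrow X$ be the inverse of $\Phi$, with components $\Psi_j:Y\dashrightarrow\mathbb{P}^{n_j}$. Fix a minimal set of multi-forms generating the homogeneous ideal of the graph $\Gamma(\Phi)$ in the $\mathbb{Z}^r\times\mathbb{Z}^s$-graded ring $T=K[\mathbf{x}_1;\ldots;\mathbf{x}_r;\mathbf{y}_1;\ldots;\mathbf{y}_s]$, and for $j\in\{1,\ldots,r\}$ let $\mathfrak{J}^{(j)}$ be the $q\times(n_j+1)$ matrix over $S/J$ defined from this set as follows. Let $H_1,\ldots,H_q$ be those elements of the fixed generating set having multi-degree $(0,\ldots,0,1,0,\ldots,0;d_1,\ldots,d_s)$, with $1$ at position $j$ and $d_1,\ldots,d_s$ arbitrary (possibly different for different elements). Write $$H_k = x_0^{(j)}G_0^{(j,k)}(\mathbf{y}_1,\ldots,\mathbf{y}_s)+\cdots+x_{n_j}^{(j)}G_{n_j}^{(j,k)}(\mathbf{y}_1,\ldots,\mathbf{y}_s),\qquad k=1,\ldots,q,$$ with uniquely determined forms $G_\iota^{(j,k)}\in S=K[\mathbf{y}_1,\ldots,\mathbf{y}_s]$, and let $\mathfrak{J}^{(j)}$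 be the matrix whose $k$-th row is $(G_0^{(j,k)},\ldots,G_{n_j}^{(j,k)})$, with entries regarded in $S/J$. Then, for every $j=1,\ldots,r$, the $(S/J)$-module of representatives of $\Psi_j$ is $\ker(\mathfrak{J}^{(j)})\subseteq (S/J)^{n_j+1}$. More explicitly, the rank of $\mathfrak{J}^{(j)}$ is $n_j$, and $\Psi_j$ is represented by the vector of signed $n_j\times n_j$-minors of any full rank $n_j\times(n_j+1)$-submatrix of $\mathfrak{J}^{(j)}$.
   Context: Rings and varieties. $R=K[\mathbf{x}_1;\ldots;\mathbf{x}_r]$ with $\mathbf{x}_j=(x_0^{(j)},\ldots,x_{n_j}^{(j)})$ carries the standard $\mathbb{Z}^r$-grading, in which each variable $x_i^{(j)}$ has degree the $j$-th standard basis vector of $\mathbb{Z}^r$; it is the homogeneous coordinate ring of $\mathbb{P}^{n_1}\times\cdots\times\mathbb{P}^{n_r}$. Likewise $S=K[\mathbf{y}_1;\ldots;\mathbf{y}_s]$ with $\mathbf{y}_i=(y_0^{(i)},\ldots,y_{m_i}^{(i)})$ carries the standard $\mathbb{Z}^s$-grading and is the homogeneous coordinate ring of $\mathbb{P}^{m_1}\times\cdots\times\mathbb{P}^{m_s}$. $T=K[\mathbf{x}_1;\ldots;\mathbf{x}_r;\mathbf{y}_1;\ldots;\mathbf{y}_s]$ carries the corresponding standard $\mathbb{Z}^r\times\mathbb{Z}^s$-grading. A homogeneous ideal of $R$ is multi-saturated if it is unchanged by successive saturation with respect to the ideals $(\mathbf{x}_1),\ldots,(\mathbf{x}_r)$ (similarly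 for $S$). $I\subset R$ and $J\subset S$ are multi-saturated homogeneous absolutely prime ideals (absolutely prime: they remain prime after extension of the base field to an algebraic closure of $K$), and $X=V(I)$, $Y=V(J)$. A multi-form, or form, is a homogeneous element with respect to the relevant multi-grading. Rational maps to a projective space. A rational map $X\dashrightarrow\mathbb{P}^m$ is an equivalence class of nonzero vectors $\mathbf{F}=(F_0,\ldots,F_m)$ of forms in $R/I$ of the same multi-degree, where $\mathbf{F}\sim\mathbf{G}$ if they define the same map $p\mapsto(F_0(p),\ldots,F_m(p))$ wherever both are defined, equivalently if $F_aG_b-F_bG_a=0$ in $R/I$ for all $a,b$. The elements of the class are called the representatives of the rational map. The map is defined at $p\in X$ if some representative does not vanish at $p$; the domain is the set of points where it is defined. The module of representatives of the rational map is the graded submodule of $(R/I)^{m+1}$ whose nonzero homogeneous vectors (vectors of forms all of the same multi-degree) are exactly the representatives. The same definitions are used for rational maps $Y\dashrightarrow\mathbb{P}^n$, with $S/J$ in place of $R/I$. Multi-rational maps. A multi-rational map $\Phi:X\dashrightarrow Y$ is an $s$-tuple $(\Phi_1,\ldots,\Phi_s)$ of rational maps $\Phi_i:X\dashrightarrow\mathbb{P}^{m_i}$ such that $\Phi(p)=(\Phi_1(p),\ldots,\Phi_s(p))$ lies in $Y$ for every $p$ in $\mathrm{Dom}(\Phi)=\bigcap_i\mathrm{Dom}(\Phi_i)$. It is dominant if the image of some (hence every) nonempty open subset of its domain is dense in $Y$. Composition of dominant multi-rational maps is obtained by substituting representatives: if $\mathbf{F}^{(1)},\ldots,\mathbf{F}^{(s)}$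 represent $\Phi_1,\ldots,\Phi_s$ and $\mathbf{G}^{(j)}$ represents $\Psi_j$, then $\mathbf{G}^{(j)}(\mathbf{F}^{(1)},\ldots,\mathbf{F}^{(s)})$ represents the $j$-th component of $\Psi\circ\Phi$. $\Phi$ is birational if it is an isomorphism in the category of multi-projective varieties and dominant multi-rational maps, i.e. there is a dominant multi-rational map $\Psi:Y\dashrightarrow X$, called the inverse of $\Phi$, with $\Psi\circ\Phi=\mathrm{id}_X$ and $\Phi\circ\Psi=\mathrm{id}_Y$ as multi-rational maps. Graph. Let $\mathbf{F}^{(i)}=(F_0^{(i)},\ldots,F_{m_i}^{(i)})$ be representatives of $\Phi_i$ (use the same notation for chosen lifts to $R$), and let $t_1,\ldots,t_s$ be new variables. The homogeneous ideal of the graph $\Gamma(\Phi)\subseteq\mathbb{P}^{n_1}\times\cdots\times\mathbb{P}^{n_r}\times\mathbb{P}^{m_1}\times\cdots\times\mathbb{P}^{m_s}$ is the contraction to $T$ of the ideal $$I+\sum_{i=1}^s\left(y_a^{(i)}-t_iF_a^{(i)}:\ a=0,\ldots,m_i\right)\subseteq K[t_1,\ldots,t_s;\mathbf{x}_1;\ldots;\mathbf{x}_r;\mathbf{y}_1;\ldots;\mathbf{y}_s];$$ it does not depend on the choice of the representatives. Rank of a matrix over the domain $S/J$ means its rank over the fraction field of $S/J$. The vector of signed $n\times n$-minors of an $n\times(n+1)$ matrix has as its $a$-th entry ($a=0,\ldots,n$) $(-1)^a$ times the determinant of the matrix obtained by deleting column $a$. *)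

(* Defs.v *)
From HB Require Import structures.
From mathcomp Require Import all_boot all_order all_algebra.
From mathcomp Require Import boolp.
From mathcomp Require Import mpoly.

Set Implicit Arguments.
Unset Strict Implicit.
Unset Printing Implicit Defensive.

Import GRing.Theory.

Local Open Scope ring_scope.
Local Open Scope quotient_scope.

(* MathComp equips the quotient by a prime ideal with the property            *)
(* [rquot_IdomainAxiom] but with no [idomainType] structure, which            *)
(* [{fraction _}] needs. Inverses are chosen classically.                     *)
Section QuotientDomain.
Variables (R : comNzRingType) (I : prime_idealr R).

Definition quot_unit : pred {ideal_quot I} :=
  fun x => `[< exists y : {ideal_quot I}, y * x = 1 >].

Definition quot_inv (x : {ideal_quot I}) : {ideal_quot I} :=
  if pselect (exists y : {ideal_quot I}, y * x = 1) is left e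
  then projT1 (cid e) else x.

Lemma quot_mulVr : {in quot_unit, left_inverse 1 quot_inv *%R}.
Proof.
move=> x /asboolP xU; rewrite /quot_inv; case: pselect => [e|//].
exact: (projT2 (cid e)).
Qed.

Lemma quot_unitPl (x y : {ideal_quot I}) : y * x = 1 -> quot_unit x.
Proof. by move=> yx1; apply/asboolP; exists y. Qed.

Lemma quot_inv_out : {in [predC quot_unit], quot_inv =1 id}.
Proof.
move=> x /asboolP xU; rewrite /quot_inv.
by case: pselect => [e|//]; case: xU.
Qed.

HB.instance Definition _ := GRing.ComNzRing_hasMulInverse.Build
  {ideal_quot I} quot_mulVr quot_unitPl quot_inv_out.

HB.instance Definition _ := GRing.ComUnitRing_isIntegral.Build
  {ideal_quot I} (@Quotient.rquot_IdomainAxiom R I).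

End QuotientDomain.

Section Ideals.
Variable R : comNzRingType.

Definition ideal_gen (G : R -> Prop) (f : R) : Prop :=
  exists (k : nat) (c g : 'I_k -> R),
    (forall i, G (g i)) /\ f = \sum_(i < k) c i * g i.

Definition ideal_pow (B : R -> Prop) (N : nat) : R -> Prop :=
  ideal_gen (fun g => exists b : 'I_N -> R,
    (forall i, B (b i)) /\ g = \prod_(i < N) b i).

Definition saturation (I B : R -> Prop) (f : R) : Prop :=
  exists N : nat, forall g, ideal_pow B N g -> I (f * g).

Definition is_prime (P : R -> Prop) : Prop :=
  ~ P 1 /\ forall f g, P (f * g) -> P f \/ P g.

Definition generates (P : R -> Prop) (gs : seq R) : Prop :=
  forall f, P f <-> ideal_gen (fun g => g \in gs) f.

End Ideals.

(* The variables of K[x_1; ...; x_r], for any finite set [A] of blocks: the   *)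
(* pair of a block [j] and of an index [a] in [0, n j].                       *)
Notation mvar n := {j & 'I_(n j).+1}.

Notation mring K n := {mpoly K[#|{: mvar n}|]}.

Section MultigradedRing.
Variables (A : finType) (n : A -> nat).

Definition mrank (j : A) (a : 'I_(n j).+1) : 'I_#|{: mvar n}| :=
  enum_rank (Tagged (fun j => 'I_(n j).+1) a).

Definition xvar (K : nzRingType) (j : A) (a : 'I_(n j).+1) : mring K n :=
  'X_(mrank a).

Definition blockdeg (u : 'X_{1..#|{: mvar n}|}) (j : A) : nat :=
  \sum_(a < (n j).+1) u (mrank a).

(* As usual, 0 is a form of every multidegree. *)
Definition multiform (K : nzRingType) (d : A -> nat) (f : mring K n) : Prop :=
  forall u, u \in msupp f -> forall j, blockdeg u j = d j.

Definition homogeneous_ideal (K : fieldType) (I : {pred mring K n}) : Prop :=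
  forall f, f \in I ->
    ideal_gen (fun g => g \in I /\ exists d, multiform d g) f.

Definition irrelevant (K : fieldType) (j : A) : mring K n -> Prop :=
  ideal_gen (fun g => exists a : 'I_(n j).+1, g = xvar K a).

Definition multisaturated (K : fieldType) (I : {pred mring K n}) : Prop :=
  forall f,
    foldl (fun (P : mring K n -> Prop) j => saturation P (@irrelevant K j))
      (fun g => g \in I) (enum A) f <-> f \in I.

Section Geometry.
Variables (K : fieldType) (L : closedFieldType) (iota : {rmorphism K -> L}).

Definition absolutely_prime (I : {pred mring K n}) : Prop :=
  is_prime (ideal_gen (fun g : mring L n =>
    exists2 f, f \in I & g = map_mpoly iota f)).

Definition multiprojective_ideal (I : {pred mring K n}) : Prop :=
  [/\ homogeneous_ideal I, multisaturated I & absolutely_prime I].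

(* Points of the product of projective spaces over [L], by homogeneous        *)
(* coordinates; every notion below is invariant under scaling of each block.  *)
Definition mpoint := forall j : A, 'rV[L]_(n j).+1.

Definition is_point (p : mpoint) : Prop := forall j, p j != 0.

Definition coords (p : mpoint) (v : 'I_#|{: mvar n}|) : L :=
  p (tag (enum_val v)) 0 (tagged (enum_val v)).

Definition on_variety (I : {pred mring K n}) (p : mpoint) : Prop :=
  is_point p /\
  forall f, f \in I -> (map_mpoly iota f).@[coords p] = 0.

Definition zariski_closed (Z : mpoint -> Prop) : Prop :=
  exists E : mring L n -> Prop,
    (forall f, E f -> exists d, multiform d f) /\
    (forall p, is_point p -> (Z p <-> forall f, E f -> f.@[coords p] = 0)).

Definition evalv (k : nat) (f : 'I_k -> mring K n) (p : mpoint) : 'rV[L]_k :=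
  \row_a (map_mpoly iota (f a)).@[coords p].

End Geometry.

Section RationalMaps.
Variables (K : fieldType) (I : idealr (mring K n)).

Definition qform (d : A -> nat) (c : {ideal_quot I}) : Prop :=
  exists2 f : mring K n, multiform d f & c = \pi_({ideal_quot I}) f.

Definition homog_vector (k : nat) (v : 'cV[{ideal_quot I}]_k) : Prop :=
  exists d, forall a, qform d (v a 0).

Definition form_vector (k : nat) (v : 'cV[{ideal_quot I}]_k) : Prop :=
  v != 0 /\ homog_vector v.

(* A rational map to P^k is given by one vector [F] representing it;          *)
(* [represents F] is its class, the set of all its representatives.           *)
Definition represents (k : nat) (F G : 'cV[{ideal_quot I}]_k) : Prop :=
  [/\ form_vector F, form_vector G &
      forall a b, F a 0 * G b 0 - F b 0 * G a 0 = 0].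

Definition class_vector (k : nat) (f : 'I_k -> mring K n) :
  'cV[{ideal_quot I}]_k := \col_a \pi_({ideal_quot I}) (f a).

Definition id_component (j : A) : 'cV[{ideal_quot I}]_(n j).+1 :=
  class_vector (fun a => xvar K a).

Definition is_rep_module (k : nat) (F : 'cV[{ideal_quot I}]_k)
    (N : 'cV[{ideal_quot I}]_k -> Prop) : Prop :=
  [/\ N 0,
      forall c v w, N v -> N w -> N (c *: v + w),
      forall v, N v -> exists (l : nat) (w : 'I_l -> 'cV[{ideal_quot I}]_k),
        (forall i, N (w i) /\ homog_vector (w i)) /\ v = \sum_(i < l) w i &
      forall v, form_vector v -> (N v <-> represents F v)].

End RationalMaps.

End MultigradedRing.

Section MultirationalMaps.
Variables (A B : finType) (n : A -> nat) (m : B -> nat) (K : fieldType).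

Definition multimap (I : idealr (mring K n)) :=
  forall i : B, 'cV[{ideal_quot I}]_(m i).+1.

Variables (L : closedFieldType) (iota : {rmorphism K -> L}).
Variables (I : idealr (mring K n)) (J : idealr (mring K m)).

(* For [p] on V(I): the map [phi] is defined at [p], and [v] is a vector of   *)
(* homogeneous coordinates of its value.                                      *)
Definition value_at (k : nat) (phi : 'cV[{ideal_quot I}]_k)
    (p : mpoint n L) (v : 'rV[L]_k) : Prop :=
  exists (f : 'I_k -> mring K n) (c : L),
    [/\ represents phi (class_vector I f), evalv iota f p != 0,
        c != 0 & v = c *: evalv iota f p].

Definition in_domain (Phi : multimap I) (p : mpoint n L) : Prop :=
  on_variety iota I p /\ forall i, exists v, value_at (Phi i) p v.

Definition maps_to (Phi : multimap I) (p : mpoint n L) (q : mpoint m L) :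
  Prop := forall i, value_at (Phi i) p (q i).

Definition multirational (Phi : multimap I) : Prop :=
  (forall i, form_vector (Phi i)) /\
  (forall p q, in_domain Phi p -> maps_to Phi p q -> on_variety iota J q).

(* [Z] is the complement of the nonempty open subset of the domain. *)
Definition dominant (Phi : multimap I) : Prop :=
  exists Z : mpoint n L -> Prop,
    let U p := on_variety iota I p /\ ~ Z p in
    [/\ zariski_closed Z,
        exists p, U p,
        forall p, U p -> in_domain Phi p &
        forall W : mpoint m L -> Prop, zariski_closed W ->
          (forall p q, U p -> maps_to Phi p q -> W q) ->
          forall q, on_variety iota J q -> W q].

Definition substitute (Phi : multimap I) (g : mring K m) : {ideal_quot I} :=
  mmap (\pi_({ideal_quot I}) \o @mpolyC _ K)
    (fun v => Phi (tag (enum_val v)) (tagged (enum_val v)) 0) g.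

(* Independent of the lift [repr] when [Phi] maps V(I) to V(J). *)
Definition compose (Phi : multimap I) (k : nat) (G : 'cV[{ideal_quot J}]_k) :
  'cV[{ideal_quot I}]_k := \col_a substitute Phi (repr (G a 0)).

End MultirationalMaps.

Section Inverse.
Variables (A B : finType) (n : A -> nat) (m : B -> nat) (K : fieldType).
Variables (L : closedFieldType) (iota : {rmorphism K -> L}).
Variables (I : idealr (mring K n)) (J : idealr (mring K m)).

Definition birational_with_inverse
    (Phi : multimap m I) (Psi : multimap n J) : Prop :=
  [/\ multirational iota J Phi /\ dominant iota J Phi,
      multirational iota I Psi /\ dominant iota I Psi,
      forall j, represents (id_component I j) (compose Phi (Psi j)) &
      forall i, represents (id_component J i) (compose Psi (Phi i))].

End Inverse.

Section Graph.
Variables (r s : nat) (n : 'I_r -> nat) (m : 'I_s -> nat) (K : fieldType).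

Definition nm (b : 'I_r + 'I_s) : nat :=
  match b with inl j => n j | inr i => m i end.

(* T = K[x; y] *)
Local Notation T := (mring K nm).

Definition Tx (j : 'I_r) (a : 'I_(n j).+1) : T := @xvar _ nm K (inl j) a.
Definition Ty (i : 'I_s) (a : 'I_(m i).+1) : T := @xvar _ nm K (inr i) a.

Definition Tembx (f : mring K n) : T :=
  mmap (@mpolyC _ K) (fun v => Tx (tagged (enum_val v))) f.

Definition Temby (g : mring K m) : T :=
  mmap (@mpolyC _ K) (fun v => Ty (tagged (enum_val v))) g.

(* K[t; x; y] is T[t], so that contraction to T is restriction to constants. *)
Definition graph_gens (I : {pred mring K n})
    (F : forall i : 'I_s, 'I_(m i).+1 -> mring K n) (h : {mpoly T[s]}) : Prop :=
  (exists2 f, f \in I & h = (Tembx f)%:MP) \/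
  (exists (i : 'I_s) (a : 'I_(m i).+1),
     h = (Ty a)%:MP - 'X_i * (Tembx (F i a))%:MP).

Definition graph_ideal (I : {pred mring K n})
    (F : forall i : 'I_s, 'I_(m i).+1 -> mring K n) (h : T) : Prop :=
  ideal_gen (graph_gens I F) h%:MP.

Definition minimal_form_generators (P : T -> Prop) (gs : seq T) : Prop :=
  [/\ uniq gs,
      forall h, h \in gs -> exists d, multiform d h,
      generates P gs &
      forall gs', {subset gs' <= gs} -> generates P gs' ->
        {subset gs <= gs'}].

(* For a nonzero multiform [h]: its multidegree is (0, .., 1, .., 0; d) for   *)
(* some d, with 1 at position j.                                              *)
Definition xlinear (j : 'I_r) (h : T) : bool :=
  all (fun u => [forall k, blockdeg u (inl k) == (k == j)]) (msupp h).

(* T viewed as S[x]. *)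
Definition as_xpoly (h : T) : {mpoly (mring K m)[#|{: mvar n}|]} :=
  mmap (@mpolyC _ (mring K m) \o @mpolyC _ K)
    (fun v => match enum_val v with
              | existT (inl j) a => @xvar _ n (mring K m) j a
              | existT (inr i) a => (@xvar _ m K i a)%:MP
              end) h.

(* The form G_a in h = \sum_a x_a^(j) G_a(y); see [xcoef_sum]. *)
Definition xcoef (j : 'I_r) (a : 'I_(n j).+1) (h : T) : mring K m :=
  (as_xpoly h)@_(U_(mrank a)).

Lemma as_xpolyX (j : 'I_r) (a : 'I_(n j).+1) :
  as_xpoly (Tx a) = xvar (mring K m) a.
Proof. by rewrite /as_xpoly /Tx /xvar mmapX mmap1U /mrank enum_rankK. Qed.

Lemma as_xpolyY (i : 'I_s) (a : 'I_(m i).+1) :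
  as_xpoly (Ty a) = (xvar K a)%:MP.
Proof. by rewrite /as_xpoly /Ty /xvar mmapX mmap1U /mrank enum_rankK. Qed.

Lemma as_xpolyM (f g : T) : as_xpoly (f * g) = as_xpoly f * as_xpoly g.
Proof. exact: (rmorphM (mmap (@mpolyC _ (mring K m) \o @mpolyC _ K) _)). Qed.

Lemma as_xpoly_sum k (f : 'I_k -> T) :
  as_xpoly (\sum_i f i) = \sum_i as_xpoly (f i).
Proof. exact: (rmorph_sum (mmap (@mpolyC _ (mring K m) \o @mpolyC _ K) _)). Qed.

Lemma as_xpoly_Temby g : as_xpoly (Temby g) = g%:MP.
Proof.
rewrite {2}[g]mpolyE rmorph_sum /= /Temby [X in as_xpoly X]/mmap.
rewrite /as_xpoly (rmorph_sum (mmap (@mpolyC _ (mring K m) \o @mpolyC _ K) _)).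
apply: eq_bigr => u _; rewrite rmorphM /= mmapC /=.
rewrite -mul_mpolyC rmorphM /=; congr (_ * _).
rewrite mpolyXE_id /mmap1 !rmorph_prod; apply: eq_bigr => v _ /=.
rewrite !rmorphXn /=; congr (_ ^+ _).
rewrite [LHS]as_xpolyY /xvar; congr (_ %:MP); congr 'X_ _.
rewrite /mrank -[RHS]enum_valK; congr enum_rank.
by case: (enum_val v).
Qed.

Lemma xcoef_sum (j : 'I_r) (G : 'I_(n j).+1 -> mring K m) a :
  xcoef a (\sum_b Tx b * Temby (G b)) = G a.
Proof.
rewrite /xcoef as_xpoly_sum raddf_sum (bigD1 a) //= big1 ?addr0.
  rewrite as_xpolyM as_xpolyX as_xpoly_Temby mulrC mcoeffCM mcoeffX.
  by rewrite eqxx mulr1.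
move=> b nba; rewrite as_xpolyM as_xpolyX as_xpoly_Temby mulrC mcoeffCM mcoeffX.
case: eqP => [/mnmP /(_ (mrank a))|_]; last by rewrite mulr0.
rewrite !mnm1E eqxx; case: eqP => // /enum_rank_inj /eqP.
by rewrite eq_Tagged /= (negPf nba).
Qed.

Definition xlinear_gens (gs : seq T) (j : 'I_r) : seq T :=
  [seq h <- gs | xlinear j h].

Definition Jmatrix (J : idealr (mring K m)) (gs : seq T) (j : 'I_r) :
  'M[{ideal_quot J}]_(size (xlinear_gens gs j), (n j).+1) :=
  \matrix_(k, a) \pi_({ideal_quot J}) (xcoef a (xlinear_gens gs j)`_k).

End Graph.

Definition frac_rank (D : idomainType) (p q : nat) (M : 'M[D]_(p, q)) : nat :=
  \rank (map_mx (@tofrac D) M).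

Definition signed_minors (D : comNzRingType) (k : nat) (M : 'M[D]_(k, k.+1)) :
  'cV[D]_k.+1 := \col_a ((-1) ^+ a * \det (col' a M)).

(* Main.v *)
(** Let P be a vector of forms over S representing Psi_j. By the Nullstellensatz,
    "Psi maps Y to X" and "Phi maps X to Y" mean that substituting Psi kills I
    and substituting Phi kills J. Over the fraction field of S/J one has
    F^(i)(Psi) = mu_i y^(i) with mu_i nonzero, so the homomorphism x -> Psi,
    y -> y, t_i -> 1/mu_i kills the generators of the ideal defining the graph.
    Hence every row of the matrix annihilates P, and a form of the graph ideal
    of x-degree 0 lies in J.

    Conversely P(F) is proportional to x^(j) over R/I, so x_b P_a - x_a P_b lies
    in the graph ideal. Expanding it on the generators and comparing the
    coefficients of x^(j), only generators linear in x^(j) survive modulo J: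
    the vectors P_a e_b - P_b e_a are combinations of rows of the matrix.
    So the kernel is the set of all v proportional to P, which has rank 1. *)

From HB Require Import structures.
Require Import Defs.
From mathcomp Require Import all_boot all_order all_algebra.
From mathcomp Require Import boolp.
From mathcomp Require Import mpoly.

Set Implicit Arguments.
Unset Strict Implicit.
Unset Printing Implicit Defensive.

Import GRing.Theory.
Local Open Scope ring_scope.
Local Open Scope quotient_scope.

(** * Extension of homomorphisms into an algebraically closed field *)

Section HomExtension.
Variables (A : idomainType) (E : fieldType) (L : closedFieldType).
Variables (ev : {rmorphism A -> E}) (w : E).

Local Notation at_w f := (map_poly ev f).[w].

(** Truncating [f] at the size of its image discards only coefficients killed by [ev], after which
    the leading coefficient survives [ev]. *)
Lemma take_poly_lead (f : {poly A}) : map_poly ev f != 0 ->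
  exists g : {poly A}, [/\ (size g <= size f)%N, ev (lead_coef g) != 0 &
    map_poly ev g = map_poly ev f].
Proof.
set h := map_poly ev f => h0; pose g := take_poly (size h) f.
have hg : map_poly ev g = h.
  apply/polyP => i; rewrite coef_map coef_take_poly.
  case: ltnP => ih; first by rewrite /h coef_map.
  by rewrite raddf0 nth_default.
have sg : size g = size h.
  apply/anti_leq; rewrite size_take_poly /= -hg.
  exact: (leq_trans (size_poly _ _)).
exists g; split=> //; first by rewrite sg; exact: size_poly.
by rewrite -coef_map hg sg -/(lead_coef h) lead_coef_eq0.
Qed.

Section Algebraic.
Variable g : {poly A}.
Hypotheses (g_lead : ev (lead_coef g) != 0) (g_root : at_w g = 0).
Hypothesis g_min : forall f : {poly A},
  (size f < size g)%N -> at_w f = 0 -> map_poly ev f = 0.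

Lemma at_w_modp (f h : {poly A}) :
  ev (lead_coef h) ^+ scalp f h * at_w f = at_w (f %/ h) * at_w h + at_w (f %% h).
Proof.
have := congr1 (fun p => at_w p) (Pdiv.Idomain.divp_eq f h).
by rewrite -mul_polyC !(rmorphM, rmorphD) /= map_polyC /= !(hornerM, hornerD)
   hornerC rmorphXn.
Qed.

Let g0 : g != 0.
Proof. by apply: contraNneq g_lead => ->; rewrite lead_coef0 rmorph0. Qed.

(** Euclid's algorithm with pseudo-division: dividing [q] by [g], or [g] by [q], leaves a smaller
    remainder, and an inverse of its value up to a factor [ev a] gives one for [q]. *)
Lemma algebraic_inverse (q : {poly A}) : at_w q != 0 ->
  exists (u : {poly A}) (a : A), ev a != 0 /\ at_w (u * q) = ev a.
Proof.
elim: {q}(size q).+1 {-2}q (ltnSn (size q)) => // k IH q.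
rewrite ltnS => sqk q0.
have /take_poly_lead [q' [sq' lq' eq']] : map_poly ev q != 0.
  by apply: contraNneq q0 => ->; rewrite horner0.
suff [u [a [a0 ua]]] : exists (u : {poly A}) (a : A),
    ev a != 0 /\ at_w (u * q') = ev a.
  by exists u, a; rewrite rmorphM /= -eq' -rmorphM.
have {q0} q0 : at_w q' != 0 by rewrite eq'.
have {sqk sq'} sqk := leq_trans sq' sqk; clear q eq'; move: q' => q in lq' q0 sqk *.
have qn0 : q != 0 by apply: contraNneq lq' => ->; rewrite lead_coef0 rmorph0.
case: (leqP (size g) (size q)) => sgq.
  have Hm := at_w_modp q g; rewrite g_root mulr0 add0r in Hm.
  have r0 : at_w (q %% g) != 0 by rewrite -Hm mulf_neq0 // expf_neq0.
  have [|u [a [a0 ua]]] := IH (q %% g) _ r0.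
    by rewrite (leq_trans _ sqk) // (leq_trans _ sgq) // ltn_modp.
  exists ((lead_coef g ^+ scalp q g)%:P * u), a; split=> //.
  by rewrite -ua !rmorphM /= !hornerM map_polyC hornerC /= rmorphXn -Hm mulrCA mulrA.
have [sq1|sq1] := leqP (size q) 1.
  have qC := size1_polyC sq1; exists 1, q`_0; rewrite mul1r.
  by move: q0; rewrite qC map_polyC hornerC coefC.
have Hm := at_w_modp g q; rewrite g_root mulr0 in Hm.
have [r0|r0] := eqVneq (at_w (g %% q)) 0; last first.
  have [|u [a [a0 ua]]] := IH (g %% q) _ r0.
    by rewrite (leq_trans _ sqk) // ltn_modp.
  exists (- u * (g %/ q)), a; split=> //.
  have re : at_w (g %% q) = - (at_w (g %/ q) * at_w q).
    by apply/eqP; rewrite -addr_eq0 addrC -Hm.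
  by rewrite -ua !(rmorphM, rmorphN) /= !(hornerM, hornerN) re mulrN !mulNr mulrA.
(* Quotient and remainder are both shorter than [g] and vanish at [w], so by minimality their images
   are zero. Then the image of [g] is zero, against the choice of its leading coefficient. *)
have := esym Hm; rewrite r0 addr0 => /eqP; rewrite mulf_eq0 (negPf q0) orbF => /eqP e0.
have e0' : map_poly ev (g %/ q) = 0.
  apply: g_min => //; rewrite size_divp //.
  have : (0 < size g)%N by rewrite size_poly_gt0.
  by case: (size q) sq1 => [|[|l]] //=; case: (size g) => // p _ _; rewrite subSS ltnS leq_subr.
have r0' : map_poly ev (g %% q) = 0.
  by apply: g_min => //; rewrite (ltn_trans _ sgq) // ltn_modp.
have := congr1 (map_poly ev) (Pdiv.Idomain.divp_eq g q).
rewrite -mul_polyC !(rmorphD, rmorphM) /= e0' r0' mul0r addr0 map_polyC /=.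
move/eqP; rewrite mulf_eq0 polyC_eq0 rmorphXn expf_eq0 (negPf lq') andbF /=.
move/eqP/polyP/(_ (size g).-1); rewrite coef_map coef0 => gl.
by case/eqP: g_lead.
Qed.

(** Any root [c] of the image of [g] works: pseudo-division by [g] transfers every relation of [w]
    to [c], and the relation [u q = a] keeps [q] nonzero at [c]. *)
Lemma algebraic_extension (q : {poly A}) : at_w q != 0 ->
  exists2 a, ev a != 0 & forall phi : {rmorphism A -> L},
    (forall x, ev x = 0 -> phi x = 0) -> phi a != 0 ->
    exists c, (map_poly phi q).[c] != 0 /\
      forall f, at_w f = 0 -> (map_poly phi f).[c] = 0.
Proof.
move=> /algebraic_inverse [u [a [a0 ua]]].
exists (lead_coef g * a) => [|phi kphi]; first by rewrite rmorphM mulf_neq0.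
rewrite rmorphM mulf_eq0 negb_or => /andP[lg0 pa0].
have [c /eqP gc] : exists c, root (map_poly phi g) c.
  apply/closed_rootP; rewrite size_map_poly_id0 //; apply: contraTneq isT => sg.
  have gC := size1_polyC (eq_leq sg).
  have := g_root; rewrite gC map_polyC hornerC => e0.
  by move: g_lead; rewrite gC lead_coefC e0 eqxx.
have van f : at_w f = 0 -> (map_poly phi f).[c] = 0.
  move=> f0; have := at_w_modp f g; rewrite f0 g_root !mulr0 add0r => /esym r0.
  have {}r0 : map_poly ev (f %% g) = 0 by apply: g_min => //; rewrite ltn_modp.
  have r0' : map_poly phi (f %% g) = 0.
    apply/polyP => i; rewrite coef_map coef0; apply: kphi.
    by have /polyP/(_ i) := r0; rewrite coef_map coef0.
  have := congr1 (fun p => (map_poly phi p).[c]) (Pdiv.Idomain.divp_eq f g).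
  rewrite -mul_polyC !(rmorphM, rmorphD) /= r0' addr0 !hornerM gc mulr0.
  rewrite map_polyC hornerC /= rmorphXn => /eqP.
  by rewrite mulf_eq0 expf_eq0 (negPf lg0) andbF => /eqP.
exists c; split=> //; have := van (u * q - a%:P).
rewrite !(rmorphB, rmorphM) /= !map_polyC !(hornerD, hornerN, hornerC, hornerM) /=.
rewrite -ua rmorphM /= hornerM subrr => /(_ erefl)/eqP; rewrite subr_eq0 => /eqP e.
by apply: contraNneq pa0 => q0; rewrite -e q0 mulr0.
Qed.

End Algebraic.

(** If [w] is algebraic over the image of [ev], a polynomial of least size witnessing this plays the
    role of the minimal polynomial; otherwise [w] is transcendental. *)
Lemma simple_extension (q : {poly A}) : at_w q != 0 ->
  exists2 a, ev a != 0 & forall phi : {rmorphism A -> L},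
    (forall x, ev x = 0 -> phi x = 0) -> phi a != 0 ->
    exists c, (map_poly phi q).[c] != 0 /\
      forall f, at_w f = 0 -> (map_poly phi f).[c] = 0.
Proof.
move=> q0.
pose P k := `[< exists g : {poly A},
  [/\ size g = k, ev (lead_coef g) != 0 & at_w g = 0] >].
have [exP|nP] := pselect (exists k, P k).
  case: (ex_minnP exP) => k /asboolP[g [sg lg rg]] kmin.
  apply: (algebraic_extension lg rg) => // f sf f0.
  apply/eqP/negP => /negP/take_poly_lead[f' [sf' lf' ef']].
  have : P (size f') by apply/asboolP; exists f'; rewrite ef'.
  by move/kmin; rewrite leqNgt -sg (leq_ltn_trans sf').
(* Transcendental case: a polynomial vanishing at [w] has all its coefficients in the kernel of
   [ev], so [c] only has to avoid the roots of the image of [q]. *)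
have tr f : at_w f = 0 -> map_poly ev f = 0.
  move=> f0; apply/eqP/negP => /negP/take_poly_lead[f' [sf' lf' ef']].
  by case: nP; exists (size f'); apply/asboolP; exists f'; rewrite ef'.
have /take_poly_lead[q' [_ lq' eq']] : map_poly ev q != 0.
  by apply: contraNneq q0 => ->; rewrite horner0.
set i := (size q').-1; exists q`_i.
  by rewrite -coef_map -eq' coef_map.
move=> phi kphi qi0.
have /closed_nonrootP[c qc] : map_poly phi q != 0.
  by apply: contraNneq qi0 => e; rewrite -coef_map e coef0.
exists c; split=> // f /tr f0.
suff -> : map_poly phi f = 0 by rewrite horner0.
apply/polyP => k; rewrite coef_map coef0; apply: kphi.
by have /polyP/(_ k) := f0; rewrite coef_map coef0.
Qed.

End HomExtension.

Lemma rmorph_mmap (n : nat) (R : nzRingType) (S S' : comNzRingType)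
    (g : {rmorphism S -> S'}) (f : R -> S) (h : 'I_n -> S) (p : {mpoly R[n]}) :
  g (mmap f h p) = mmap (g \o f) (g \o h) p.
Proof.
rewrite /mmap rmorph_sum; apply: eq_bigr => u _ /=.
rewrite rmorphM /mmap1 rmorph_prod; congr (_ * _).
by apply: eq_bigr => i _; rewrite rmorphXn.
Qed.

Lemma eq_mmap (n : nat) (R S : nzRingType) (f g : R -> S) (h k : 'I_n -> S)
  (p : {mpoly R[n]}) : f =1 g -> h =1 k -> mmap f h p = mmap g k p.
Proof.
move=> fg hk; apply: eq_bigr => u _; rewrite fg; congr (_ * _).
by apply: eq_bigr => i _; rewrite hk.
Qed.

Lemma mmap_mmap (n k : nat) (R : nzRingType) (S S' : comNzRingType)
    (g : {rmorphism S -> S'}) (z : 'I_k -> S')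
    (f : R -> {mpoly S[k]}) (h : 'I_n -> {mpoly S[k]}) (p : {mpoly R[n]}) :
  mmap g z (mmap f h p) = mmap (mmap g z \o f) (mmap g z \o h) p.
Proof. exact: rmorph_mmap. Qed.

(* The conclusion is stated for every [phi] killing the kernel of [ev], so that *)
(* [A] need not embed in [E] and each variable can be absorbed into [A].      *)
Lemma finite_extension (E : fieldType) (L : closedFieldType) (N : nat)
    (A : idomainType) (ev : {rmorphism A -> E}) (z : 'I_N -> E)
    (q : {mpoly A[N]}) : mmap ev z q != 0 ->
  exists2 a, ev a != 0 & forall phi : {rmorphism A -> L},
    (forall x, ev x = 0 -> phi x = 0) -> phi a != 0 ->
    exists p : 'I_N -> L, mmap phi p q != 0 /\
      forall f, mmap ev z f = 0 -> mmap phi p f = 0.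
Proof.
elim: N A ev z q => [|N IH] A ev z q q0.
  have mC (S : comNzRingType) (g : {rmorphism A -> S}) (y : 'I_0 -> S) f :
      mmap g y f = g f@_0%MM.
    have {1}-> : f = (f@_0%MM)%:MP.
      apply/mpolyP => u; rewrite mcoeffC.
      have -> : u = 0%MM by apply/mnmP => -[].
      by rewrite eqxx mulr1.
    by rewrite mmapC.
  exists q@_0%MM; first by rewrite -(mC _ ev z).
  move=> phi kphi pq; exists (fun _ => 0); split; first by rewrite mC.
  by move=> f; rewrite !mC => /kphi.
(* The first variable moves into the base ring: [T] rewrites a polynomial over [A] as one in the
   remaining variables over [{poly A}]. *)
pose ev' : {rmorphism {poly A} -> E} := horner_eval (z ord0) \o map_poly ev.
pose z' i := z (lift ord0 i).
pose X (i : 'I_N.+1) : {mpoly {poly A}[N]} :=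
  if unlift ord0 i is Some k then 'X_k else 'X%:MP.
pose T (f : {mpoly A[N.+1]}) := mmap (@mpolyC N {poly A} \o polyC) X f.
have TE (S : comNzRingType) (g : {rmorphism {poly A} -> S}) (h : {rmorphism A -> S})
    (y : 'I_N.+1 -> S) f : (forall a, g a%:P = h a) -> g 'X = y ord0 ->
    mmap g (fun i => y (lift ord0 i)) (T f) = mmap h y f.
  move=> gC gX; rewrite mmap_mmap; apply: eq_mmap => [a|i] /=.
    by rewrite mmapC; apply: gC.
  rewrite /X; case: unliftP => [k|] -> /=; first by rewrite mmapX mmap1U.
  by rewrite mmapC; apply: gX.
have evC a : ev' a%:P = ev a by rewrite /= /horner_eval map_polyC hornerC.
have evX : ev' 'X = z ord0 by rewrite /= /horner_eval map_polyX hornerX.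
have /IH[a' a'0 Ha'] : mmap ev' z' (T q) != 0 by rewrite (TE _ _ ev).
(* The factor [a'] given by the induction is a polynomial in the first variable; the value [c] of
   that variable is chosen so that [a'] survives. *)
have [a a0 Ha] := simple_extension L a'0.
exists a => // phi kphi pa; have [c [ca' kc]] := Ha _ kphi pa.
pose phi' : {rmorphism {poly A} -> L} := horner_eval c \o map_poly phi.
have [p [pq kp]] := Ha' phi' kc ca'.
pose y (i : 'I_N.+1) := if unlift ord0 i is Some k then p k else c.
have TE' f : mmap phi' p (T f) = mmap phi y f.
  rewrite -(TE _ phi' phi y).
  - by apply: eq_mmap => // i; rewrite /y liftK.
  - by move=> b; rewrite /= /horner_eval map_polyC hornerC.
  - by rewrite /= /horner_eval map_polyX hornerX /y unlift_none.
exists y; split; first by rewrite -TE'.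
by move=> f f0; rewrite -TE'; apply: kp; rewrite (TE _ _ ev).
Qed.

(** * Vectors proportional to a given vector *)

(** The last clause of [represents], freed from the requirement that the vectors be nonzero and
    homogeneous, so that it can describe a whole kernel. *)
Definition proportional (D : comNzRingType) (k : nat) (u v : 'cV[D]_k) : Prop :=
  forall a b, u a 0 * v b 0 - u b 0 * v a 0 = 0.

Lemma cV_neq0P (D : nzRingType) (k : nat) (u : 'cV[D]_k) :
  reflect (exists a, u a 0 != 0) (u != 0).
Proof.
apply: (iffP idP) => [u0|[a]]; last first.
  by apply: contraNneq => ->; rewrite mxE.
apply/existsP; apply: contraNT u0 => /existsPn h; apply/eqP/colP => a.
by rewrite mxE; apply/eqP; have := h a; rewrite negbK.
Qed.

Lemma proportionalP (D : idomainType) (k : nat) (u v : 'cV[D]_k) :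
  u != 0 -> v != 0 -> proportional u v ->
  exists2 c : {fraction D}, c != 0 &
    forall a, tofrac (v a 0) = c * tofrac (u a 0).
Proof.
move=> /cV_neq0P[a ua] /cV_neq0P[b vb] uv.
have fua : tofrac (u a 0) != 0 by rewrite tofrac_eq0.
have E c : tofrac (v c 0) = tofrac (v a 0) / tofrac (u a 0) * tofrac (u c 0).
  apply: (mulfI fua); rewrite mulrCA mulrA mulfVK // mulrC -!tofracM.
  by rewrite mulrC; congr tofrac; apply/eqP; rewrite -subr_eq0 [_ * u c 0]mulrC uv.
exists (tofrac (v a 0) / tofrac (u a 0)) => //.
by apply: contraNneq vb => c0; rewrite -tofrac_eq0 E c0 mul0r.
Qed.

(** A nonzero entry of [v] is cancelled; through [v = 0] the relation would not be transitive. *)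
Lemma proportional_trans (D : idomainType) (k : nat) (u v w : 'cV[D]_k) :
  v != 0 -> proportional u v -> proportional v w -> proportional u w.
Proof.
move=> /cV_neq0P[c vc] uv vw a b; apply: (mulfI vc).
have e1 x y : u x 0 * v y 0 = u y 0 * v x 0 by apply/eqP; rewrite -subr_eq0 uv.
have e2 x y : v x 0 * w y 0 = v y 0 * w x 0 by apply/eqP; rewrite -subr_eq0 vw.
have l : v c 0 * (u a 0 * w b 0) = u c 0 * (v b 0 * w a 0).
  by rewrite mulrA [v c 0 * _]mulrC (e1 a c) -mulrA e2.
have r : v c 0 * (u b 0 * w a 0) = u c 0 * (v b 0 * w a 0).
  by rewrite mulrA [v c 0 * _]mulrC (e1 b c) -mulrA.
by rewrite mulr0 mulrBr l r subrr.
Qed.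

(** * Matrices whose kernel is a line, and their maximal minors *)

Section OneDimensionalKernel.
Variable F : fieldType.

(** Rank-nullity; [kermx] is a left kernel, hence the transposes. *)
Lemma rank_line_kernel (q n : nat) (M : 'M[F]_(q, n.+1)) (p : 'cV[F]_n.+1) :
  p != 0 -> M *m p = 0 ->
  (forall v, M *m v = 0 -> exists c, v = c *: p :> 'cV_n.+1) -> \rank M = n.
Proof.
move=> p0 Mp kM.
have := mxrank_ker M^T; rewrite mxrank_tr.
have -> : \rank (kermx M^T) = 1%N.
  have -> : \rank (kermx M^T) = \rank p^T.
    apply/eqP; rewrite eqn_leq !mxrankS //.
      by apply/sub_kermxP; rewrite -trmx_mul Mp trmx0.
    apply/row_subP => i; have /sub_kermxP e := row_sub i (kermx M^T).
    have /kM[c e'] : M *m (row i (kermx M^T))^T = 0.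
      by apply: trmx_inj; rewrite trmx_mul trmxK e trmx0.
    by apply/sub_rVP; exists c; apply: trmx_inj; rewrite e' linearZ /= trmxK.
  by rewrite rank_rV trmx_eq0 p0.
have := rank_leq_col M; rewrite leq_eqVlt => /predU1P[->|]; first by rewrite subnn.
by rewrite ltnS => le /eqP; rewrite subSn // eqSS eq_sym subn_eq0 => ge; apply/anti_leq; rewrite le.
Qed.

Lemma kernel_full_rank (n : nat) (N : 'M[F]_(n, n.+1)) (p v : 'cV[F]_n.+1) :
  \rank N = n -> p != 0 -> N *m p = 0 -> N *m v = 0 -> exists c, v = c *: p.
Proof.
move=> rN p0 Np Nv.
have := mxrank_ker N^T; rewrite mxrank_tr rN subSnn => rk.
have pk : (p^T <= kermx N^T)%MS by apply/sub_kermxP; rewrite -trmx_mul Np trmx0.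
have vk : (v^T <= kermx N^T)%MS by apply/sub_kermxP; rewrite -trmx_mul Nv trmx0.
have kp : (kermx N^T <= p^T)%MS.
  by rewrite -(geq_leqif (mxrank_leqif_sup pk)) rk rank_rV trmx_eq0 p0.
have /sub_rVP[c e] := submx_trans vk kp; exists c.
by apply: trmx_inj; rewrite e linearZ.
Qed.

(** A kernel vector of [col' a N], padded by 0 at index [a], lies in the kernel of [N] and is thus a
    multiple of [p]; as its entry at [a] is 0 and that of [p] is not, it vanishes. *)
Lemma maximal_minor_neq0 (n : nat) (N : 'M[F]_(n, n.+1)) (p : 'cV[F]_n.+1) a :
  \rank N = n -> N *m p = 0 -> p a 0 != 0 -> \det (col' a N) != 0.
Proof.
move=> rN Np pa; have p0 : p != 0 by apply/cV_neq0P; exists a.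
rewrite -unitfE -unitmxE -unitmx_tr -row_free_unit -kermx_eq0.
apply/rowV0P => w /sub_kermxP ew.
pose v : 'cV[F]_n.+1 := \col_b if unlift a b is Some k then w 0 k else 0.
have [c ec] : exists c, v = c *: p.
  apply: (kernel_full_rank rN p0 Np); apply/colP => i; rewrite !mxE.
  rewrite (bigD1_ord a) //= mxE unlift_none mulr0 add0r.
  have /rowP/(_ i) := ew; rewrite !mxE => e; rewrite -[RHS]e.
  by apply: eq_bigr => k _; rewrite !mxE liftK mulrC.
have /colP/(_ a) := ec; rewrite !mxE unlift_none => /esym/eqP.
rewrite mulf_eq0 (negPf pa) orbF => /eqP c0.
apply/rowP => k; have /colP/(_ (lift a k)) := ec.
by rewrite c0 scale0r !mxE liftK.
Qed.

End OneDimensionalKernel.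

(** Row [k] of [N] placed on top of [N] gives a square matrix with a repeated row; its zero
    determinant, expanded along the first row, is entry [k] of the product. *)
Lemma mulmx_signed_minors (D : comNzRingType) (n : nat) (N : 'M[D]_(n, n.+1)) :
  N *m signed_minors N = 0.
Proof.
apply/colP => k; rewrite !mxE.
pose B : 'M[D]_(n.+1) := col_mx (row k N) N.
have e0 : B ord0 =1 row k N 0.
  move=> j; rewrite -(col_mxEu (row k N) N 0 j).
  by congr (col_mx _ _ _ j); apply/val_inj.
have eS i : B (lift ord0 i) =1 N i.
  move=> j; rewrite -(col_mxEd (row k N) N i j).
  by congr (col_mx _ _ _ j); apply/val_inj.
have : \det B = 0.
  apply: (@determinant_alternate _ _ _ ord0 (lift ord0 k)) => [|j].
    exact: neq_lift.
  by rewrite e0 eS mxE.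
rewrite (expand_det_row _ ord0) => e; rewrite -[RHS]e; apply: eq_bigr => a _.
rewrite e0 !mxE /cofactor add0n; congr (_ * (_ * \det _)).
by apply/matrixP => i j; rewrite [LHS]mxE [RHS]mxE [RHS]mxE eS.
Qed.

Section LineKernelDomain.
Variables (D : idomainType) (n : nat) (P : 'cV[D]_n.+1).
Hypothesis P0 : P != 0.

Let fP := map_mx (@tofrac D) P.

Let fP0 : fP != 0.
Proof.
case/cV_neq0P: P0 => a Pa; apply/cV_neq0P; exists a.
by rewrite mxE tofrac_eq0.
Qed.

(** Over the fraction field the kernel of [N] is the line through [P]; the minors lie in it, and the
    one omitting a column where [P] is nonzero does not vanish. *)
Lemma proportional_signed_minors (N : 'M[D]_(n, n.+1)) :
  N *m P = 0 -> frac_rank N = n ->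
  signed_minors N != 0 /\ proportional P (signed_minors N).
Proof.
move=> NP rN; have NfP : map_mx (@tofrac D) N *m fP = 0.
  by rewrite -map_mxM NP map_mx0.
split.
  case/cV_neq0P: fP0 => a fPa.
  have := maximal_minor_neq0 rN NfP fPa.
  rewrite -map_col' det_map_mx tofrac_eq0 => d0.
  by apply/cV_neq0P; exists a; rewrite mxE mulf_neq0 // signr_eq0.
have [c ec] : exists c, map_mx (@tofrac D) (signed_minors N) = c *: fP.
  apply: (kernel_full_rank rN fP0 NfP).
  by rewrite -map_mxM mulmx_signed_minors map_mx0.
have e a : tofrac (signed_minors N a 0) = c * tofrac (P a 0).
  by have /colP/(_ a) := ec; rewrite !mxE.
move=> a b; apply/eqP; rewrite -tofrac_eq0 tofracB !tofracM !e.
by rewrite mulrCA [X in _ - X]mulrCA [X in c * X]mulrC subrr.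
Qed.

Variables (q : nat) (M : 'M[D]_(q, n.+1)).
Hypothesis MP : M *m P = 0.
Hypothesis span : forall a b, exists c : 'rV[D]_q,
  c *m M = P a 0 *: delta_mx 0 b - P b 0 *: delta_mx 0 a.

(** The rows supplied by [span], applied to [v], are the 2 by 2 minors of [P] and [v]. Conversely
    proportionality gives [P_b M v = v_b M P = 0], and a nonzero [P_b] is cancelled. *)
Lemma line_kernelE (v : 'cV[D]_n.+1) : M *m v = 0 <-> proportional P v.
Proof.
split=> [Mv a b|Pv].
  have [c ec] := span a b; have := congr1 (mulmx c) Mv.
  rewrite mulmxA ec mulmx0 mulmxBl -!scalemxAl => /matrixP/(_ 0 0).
  by rewrite -!rowE !mxE.
case/cV_neq0P: P0 => b Pb; apply/colP => k; apply: (mulfI Pb).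
rewrite [X in _ = _ * X]mxE mulr0 mxE mulr_sumr.
have /colP/(_ k) := MP; rewrite !mxE => /(congr1 ( *%R (v b 0))).
rewrite mulr0 mulr_sumr => e; rewrite -[RHS]e; apply: eq_bigr => a _.
rewrite mulrCA [RHS]mulrCA; congr (_ * _); apply/eqP.
by rewrite [v b 0 * _]mulrC -subr_eq0 Pv.
Qed.

(** The same pairing over the fraction field shows that the kernel is the line through [P]. *)
Lemma frac_rank_line_kernel : frac_rank M = n.
Proof.
apply: (rank_line_kernel fP0); first by rewrite -map_mxM MP map_mx0.
move=> v Mv; case/cV_neq0P: fP0 => b fPb; exists (v b 0 / fP b 0).
apply/colP => a; apply: (mulfI fPb); rewrite [X in _ = _ * X]mxE [RHS]mulrA.
rewrite [X in _ = X * _]mulrC mulfVK //.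
have [c ec] := span b a; have := congr1 (mulmx (map_mx (@tofrac D) c)) Mv.
rewrite mulmxA -map_mxM ec mulmx0 => /matrixP/(_ 0 0).
rewrite map_mxB !map_mxZ !map_delta_mx mulmxBl -!scalemxAl -!rowE !mxE.
by move/eqP; rewrite subr_eq0 => /eqP e; rewrite [RHS]mulrC.
Qed.

End LineKernelDomain.

(** * Multigrading *)

Section Grading.
Variables (A : finType) (n : A -> nat).
Local Notation N := #|{: mvar n}|.

Lemma big_mvar (T : Type) (idx : T) (op : Monoid.com_law idx) (F : 'I_N -> T) :
  \big[op/idx]_v F v = \big[op/idx]_(j : A) \big[op/idx]_(a < (n j).+1) F (mrank a).
Proof.
rewrite (sig_big_dep _ _ (fun j (a : 'I_(n j).+1) => F (mrank a))) /=.
rewrite (reindex (@enum_rank {: mvar n})) /=; last first.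
  by exists enum_val => x _; rewrite ?enum_rankK ?enum_valK.
by apply: eq_bigr => -[j a] _.
Qed.

Lemma mrank_tagged (v : 'I_N) : mrank (tagged (enum_val v)) = v.
Proof. by rewrite /mrank -[RHS]enum_valK; congr enum_rank; case: (enum_val v). Qed.

Lemma mrankP (v : 'I_N) : exists (j : A) (a : 'I_(n j).+1), v = mrank a.
Proof. by exists (tag (enum_val v)), (tagged (enum_val v)); rewrite mrank_tagged. Qed.

Lemma enum_val_mrank (j : A) (a : 'I_(n j).+1) :
  enum_val (mrank a) = Tagged (fun j => 'I_(n j).+1) a.
Proof. exact: enum_rankK. Qed.

Lemma mdeg_blockdeg (u : 'X_{1..N}) : mdeg u = (\sum_j blockdeg u j)%N.
Proof. by rewrite mdegE big_mvar. Qed.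

Lemma blockdegD (u v : 'X_{1..N}) j :
  blockdeg (u + v)%MM j = (blockdeg u j + blockdeg v j)%N.
Proof. by rewrite /blockdeg -big_split; apply: eq_bigr => a _; rewrite mnmE. Qed.

Lemma blockdegU (j : A) (a : 'I_(n j).+1) k :
  blockdeg U_(mrank a)%MM k = (k == j).
Proof.
rewrite /blockdeg; have [->|kj] := eqVneq k j.
  rewrite (bigD1 a) //= mnm1E eqxx big1 ?addn0 // => b ba.
  rewrite mnm1E (inj_eq enum_rank_inj) eq_Tagged /= eq_sym.
  by rewrite (negPf ba).
rewrite big1 // => b _; rewrite mnm1E (inj_eq enum_rank_inj).
by case: eqP => // /(congr1 tag) /= e; rewrite e eqxx in kj.
Qed.

Lemma blockdeg_delta (u : 'X_{1..N}) (j : A) :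
  (forall k, blockdeg u k = (k == j)) -> exists a : 'I_(n j).+1, u = U_(mrank a)%MM.
Proof.
move=> du; have : mdeg u == 1%N.
  by rewrite mdeg_blockdeg (bigD1 j) //= du eqxx big1 // => k /negPf; rewrite du => ->.
rewrite mdeg_eq1 => /existsP[v /eqP e]; have [k [a va]] := mrankP v; subst v.
have := du k; rewrite e blockdegU eqxx; case: eqP => // kj _; subst k.
by exists a.
Qed.

(** Multihomogeneity for block scalars in an arbitrary commutative ring: they will be fractions, and
    also the variables [t_i] of the graph ideal. *)
Lemma multiform_mmap (K : nzRingType) (S : comNzRingType) (f : K -> S)
    (z : 'I_N -> S) (c : A -> S) (d : A -> nat) (g : mring K n) :
  multiform d g ->
  mmap f (fun v => c (tag (enum_val v)) * z v) g
    = (\prod_j c j ^+ d j) * mmap f z g.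
Proof.
move=> dg; rewrite /mmap mulr_sumr; apply: eq_big_seq => u ug.
rewrite mulrCA; congr (_ * _); rewrite /mmap1.
rewrite (eq_bigr (fun v => c (tag (enum_val v)) ^+ u v * z v ^+ u v)); last first.
  by move=> v _; apply: exprMn.
rewrite big_split /= big_mvar; congr (_ * _); apply: eq_bigr => j _.
by rewrite -(dg _ ug) /blockdeg expr_sum; apply: eq_bigr => a _; rewrite enum_val_mrank.
Qed.

Section Forms.
Variable K : nzRingType.
Implicit Types (f g : mring K n) (e : A -> nat).

Lemma multiformP d f :
  multiform d f <-> forall u, f@_u != 0 -> forall j, blockdeg u j = d j.
Proof.
by split=> h u; [rewrite -mcoeff_msupp; apply: h | rewrite mcoeff_msupp; apply: h].
Qed.

Lemma multiform0 d : multiform d (0 : mring K n).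
Proof. by move=> u; rewrite msupp0. Qed.

Lemma multiform1 : multiform (fun=> 0%N) (1 : mring K n).
Proof.
move=> u; rewrite msupp1 inE => /eqP -> j.
by rewrite /blockdeg big1 // => a _; rewrite mnm0E.
Qed.

Lemma multiformD d f g : multiform d f -> multiform d g -> multiform d (f + g).
Proof.
move=> /multiformP df /multiformP dg; apply/multiformP => u.
rewrite mcoeffD; have [-> |/df //] := eqVneq f@_u 0.
by rewrite add0r => /dg.
Qed.

Lemma multiformM d e f g :
  multiform d f -> multiform e g -> multiform (fun j => d j + e j)%N (f * g).
Proof.
move=> df eg u /msuppM_le/allpairsP[[v w] [/= fv gw ->]] j.
by rewrite blockdegD df // eg.
Qed.

Lemma multiform_sign d (b : bool) f : multiform d f -> multiform d ((-1) ^+ b * f).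
Proof.
move=> /multiformP df; apply/multiformP => u; case: b; last by rewrite mul1r; apply: df.
by rewrite expr1 mulN1r mcoeffN oppr_eq0; apply: df.
Qed.

(** Degrees become finite functions here, so that they have decidable equality and can be listed. *)
Definition mdegs (u : 'X_{1..N}) : {ffun A -> nat} := [ffun j => blockdeg u j].

Definition component (d : {ffun A -> nat}) f : mring K n :=
  \sum_(u <- msupp f | mdegs u == d) f@_u *: 'X_[u].

Lemma mcoeff_component d f u :
  (component d f)@_u = if mdegs u == d then f@_u else 0.
Proof.
rewrite /component raddf_sum /=.
have mc v : (f@_v *: 'X_[v])@_u = if v == u then f@_u else 0.
  by rewrite mcoeffZ mcoeffX; case: eqP => [->|]; rewrite ?mulr1 ?mulr0.
have [uf|uf] := boolP (u \in msupp f); last first.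
  rewrite (memN_msupp_eq0 uf) if_same big_seq_cond big1 // => v /andP[vf _].
  by rewrite mc; case: eqP => // e; rewrite -e vf in uf.
rewrite big_mkcond (bigD1_seq u) //= mc eqxx big1 ?addr0 // => v /negPf vu.
by rewrite mc vu if_same.
Qed.

Lemma component_is_additive d : zmod_morphism (component d).
Proof.
move=> f g; apply/mpolyP => u; rewrite mcoeffB !mcoeff_component mcoeffB.
by case: ifP; rewrite // subr0.
Qed.

HB.instance Definition _ d :=
  GRing.isZmodMorphism.Build (mring K n) (mring K n) (component d)
    (component_is_additive d).

Lemma multiform_component (d : {ffun A -> nat}) f : multiform d (component d f).
Proof.
apply/multiformP => u; rewrite mcoeff_component; case: ifP => [/eqP <- _ j|_].
  by rewrite ffunE.
by rewrite eqxx.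
Qed.

Lemma component_form (d : {ffun A -> nat}) e f :
  multiform e f -> component d f = if finfun e == d then f else 0.
Proof.
move=> /multiformP ef; apply/mpolyP => u; rewrite mcoeff_component.
have [f0|f0] := eqVneq f@_u 0.
  by rewrite f0 if_same; case: ifP; rewrite ?f0 ?mcoeff0.
have -> : mdegs u = finfun e by apply/ffunP => j; rewrite !ffunE ef.
by case: ifP; rewrite ?mcoeff0.
Qed.

Definition degrees f : seq {ffun A -> nat} := undup (map mdegs (msupp f)).

(** The list may exceed the set of degrees of [f], so that one list can serve several
    polynomials. *)
Lemma component_sum (s : seq {ffun A -> nat}) f :
  uniq s -> {subset degrees f <= s} -> f = \sum_(d <- s) component d f.
Proof.
move=> us sub; apply/mpolyP => u; rewrite raddf_sum /=.
under eq_bigr do rewrite mcoeff_component.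
have [f0|f0] := eqVneq f@_u 0.
  by rewrite f0 big1 // => d _; rewrite if_same.
rewrite (bigD1_seq (mdegs u)) //=; last first.
  by apply: sub; rewrite mem_undup map_f // mcoeff_msupp.
rewrite eqxx big1 ?addr0 // => d /negPf.
by rewrite eq_sym => ->.
Qed.

(** Multiplication by a form shifts degrees injectively, so only one component of [f]
    contributes. *)
Lemma component_mulr (d : {ffun A -> nat}) e f g : multiform e g ->
  component [ffun j => (d j + e j)%N] (f * g) = component d f * g.
Proof.
move=> eg.
rewrite {1}[f](@component_sum (undup (d :: degrees f)) f) ?undup_uniq //; last first.
  by move=> c cf; rewrite mem_undup inE cf orbT.
rewrite mulr_suml raddf_sum (bigD1_seq d) ?undup_uniq ?mem_undup ?mem_head //=.
rewrite (component_form _ (multiformM (@multiform_component _ _) eg)) eqxx.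
rewrite big1 ?addr0 // => c cd.
rewrite (component_form _ (multiformM (@multiform_component _ _) eg)).
case: eqP => // e'; case/eqP: cd; apply/ffunP => j.
have /ffunP/(_ j) := e'; rewrite !ffunE => /eqP.
by rewrite eqn_add2r => /eqP.
Qed.

End Forms.

(** Once the coefficients are split into forms, each product with a generating form is a form in
    [I], which the projection keeps or sends to 0. *)
Lemma component_ideal (K : fieldType) (I : idealr (mring K n)) (d : {ffun A -> nat}) f :
  homogeneous_ideal I -> f \in I -> component d f \in I.
Proof.
move=> hI /hI[k [c [g [Ig ->]]]].
rewrite raddf_sum; apply: rpred_sum => i _ /=.
have [gI [e eg]] := Ig i.
rewrite {1}[c i](@component_sum _ (degrees (c i)) (c i)) ?undup_uniq //.
rewrite mulr_suml raddf_sum; apply: rpred_sum => b _ /=.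
rewrite (component_form _ (multiformM (@multiform_component _ _ _) eg)).
by case: ifP; rewrite ?rpred0 // idealMr.
Qed.

End Grading.

(** * Nullstellensatz and substitution *)

Definition quot_proj (R : comNzRingType) (I : idealr R) :
  {rmorphism R -> {ideal_quot I}} := \pi_({ideal_quot I}).

Lemma pi_eq0 (R : comNzRingType) (I : idealr R) (f : R) :
  (quot_proj I f == 0) = (f \in I).
Proof. by rewrite -[f in RHS]subr0 Quotient.idealrBE pi_zeror. Qed.

Lemma prime_prod_notin (R : comNzRingType) (I : prime_idealr R) (T : finType)
    (f : T -> R) : (forall i, f i \notin I) -> \prod_i f i \notin I.
Proof.
move=> fI; apply: (big_ind (fun h => h \notin I)) => //; first by rewrite idealr1.
by move=> g h gI hI; rewrite prime_idealrM negb_or gI.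
Qed.

Lemma pi_mpolyE (K : fieldType) (k : nat) (I : idealr {mpoly K[k]}) (g : {mpoly K[k]}) :
  mmap (\pi_({ideal_quot I}) \o @mpolyC _ K) (fun v => \pi_({ideal_quot I}) 'X_v) g
    = quot_proj I g.
Proof.
rewrite {2}[g]mpolyE rmorph_sum; apply: eq_bigr => u _.
rewrite -mul_mpolyC rmorphM /=; congr (_ * _).
by rewrite mpolyXE_id rmorph_prod; apply: eq_bigr => v _; rewrite rmorphXn.
Qed.

Section Nullstellensatz.
Variables (A : finType) (n : A -> nat) (K : fieldType).
Variables (L : closedFieldType) (iota : {rmorphism K -> L}).
Variable I : prime_idealr (mring K n).

Definition point_of (p : 'I_#|{: mvar n}| -> L) : mpoint n L :=
  fun j => \row_a p (mrank a).

Lemma coords_point_of p : coords (point_of p) =1 p.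
Proof. by move=> v; rewrite /coords mxE mrank_tagged. Qed.

Lemma meval_map_mpoly (p : 'I_#|{: mvar n}| -> L) (f : mring K n) :
  (map_mpoly iota f).@[p] = mmap iota p f.
Proof.
rewrite /meval /map_mpoly mmap_mmap; apply: eq_mmap => [a|v] /=.
  by rewrite mmapC.
by rewrite mmapX mmap1U.
Qed.

Lemma meval_point_of (p : 'I_#|{: mvar n}| -> L) (f : mring K n) :
  (map_mpoly iota f).@[coords (point_of p)] = mmap iota p f.
Proof. by rewrite meval_map_mpoly; apply: eq_mmap (coords_point_of p). Qed.

(** Nullstellensatz: the classes of the variables form a generic point over the fraction field of
    the quotient, and [finite_extension] specialises it to [L]. The base ring is a field, so the
    condition on [a] holds by injectivity. *)
Lemma prime_nonzero_point (g : mring K n) : g \notin I ->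
  exists p : 'I_#|{: mvar n}| -> L,
    mmap iota p g != 0 /\ forall f, f \in I -> mmap iota p f = 0.
Proof.
move=> gI; pose Q := {ideal_quot I}.
pose ev : {rmorphism K -> {fraction Q}} := @tofrac Q \o quot_proj I \o @mpolyC _ K.
pose z v : {fraction Q} := tofrac (quot_proj I 'X_v).
have evE f : mmap ev z f = tofrac (quot_proj I f) by rewrite -pi_mpolyE rmorph_mmap.
have [|a a0 /(_ iota)[]] := @finite_extension {fraction Q} L _ K ev z g.
- by rewrite evE tofrac_eq0 pi_eq0.
- by move=> x /eqP; rewrite fmorph_eq0 => /eqP ->; rewrite rmorph0.
- by rewrite fmorph_eq0; move: a0; rewrite fmorph_eq0.
move=> p [pg pI]; exists p; split=> // f fI; apply: pI.
by apply/eqP; rewrite evE tofrac_eq0 pi_eq0.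
Qed.

End Nullstellensatz.

Section Substitution.
Variables (A B : finType) (n : A -> nat) (m : B -> nat) (K : fieldType).

Lemma substitute_is_zmod_morphism (J : idealr (mring K m)) (Psi : multimap n J) :
  zmod_morphism (substitute Psi).
Proof. by move=> f g; rewrite /substitute rmorphB. Qed.

Lemma substitute_is_monoid_morphism (J : idealr (mring K m)) (Psi : multimap n J) :
  monoid_morphism (substitute Psi).
Proof. by split=> [|f g]; rewrite /substitute ?rmorph1 ?rmorphM. Qed.

HB.instance Definition _ (J : idealr (mring K m)) (Psi : multimap n J) :=
  GRing.isZmodMorphism.Build (mring K n) {ideal_quot J} (substitute Psi)
    (substitute_is_zmod_morphism Psi).
HB.instance Definition _ (J : idealr (mring K m)) (Psi : multimap n J) :=
  GRing.isMonoidMorphism.Build (mring K n) {ideal_quot J} (substitute Psi)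
    (substitute_is_monoid_morphism Psi).

Variables (L : closedFieldType) (iota : {rmorphism K -> L}).
Variables (I : idealr (mring K n)) (J : prime_idealr (mring K m)).
Variable Psi : multimap n J.

(** A polynomial lift of [substitute Psi f], which can be evaluated at points and substituted into
    again. *)
Definition substitute_lift (f : mring K n) : mring K m :=
  mmap (@mpolyC _ K)
    (fun v => repr (Psi (tag (enum_val v)) (tagged (enum_val v)) 0)) f.

Lemma pi_substitute_lift f : quot_proj J (substitute_lift f) = substitute Psi f.
Proof. by rewrite [LHS](rmorph_mmap (quot_proj J)); apply: eq_mmap => // v; apply: reprK. Qed.

(** Otherwise the Nullstellensatz gives a point of V(J) in the domain of [Psi] whose image is off
    V(I). *)
Lemma substitute_ideal f : multirational iota I Psi ->
  (forall i, id_component J i != 0) -> f \in I -> substitute Psi f = 0.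
Proof.
move=> [Psi_form Psi_on] id0 fI; apply/eqP/negP => /negP Pf.
pose Q := {ideal_quot J}.
have exa j : exists a, Psi j a 0 != 0 by apply/cV_neq0P; case: (Psi_form j).
have exb i : exists b, id_component J i b 0 != 0 by apply/cV_neq0P.
pose a j := xchoose (exa j); pose b i := xchoose (exb i).
(* Where the three factors are nonzero, [f] does not vanish at the image, every [Psi j] is defined,
   and no block of coordinates is zero. *)
pose g := substitute_lift f * (\prod_j repr (Psi j (a j) 0)) * (\prod_i xvar K (b i)).
have gJ : g \notin J.
  rewrite !prime_idealrM !negb_or -andbA; apply/and3P; split.
  - by rewrite -pi_eq0 pi_substitute_lift.
  - apply: prime_prod_notin => j; rewrite -pi_eq0 /quot_proj /= reprK.
    exact: (xchooseP (exa j)).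
  - apply: prime_prod_notin => i; rewrite -pi_eq0.
    by have := xchooseP (exb i); rewrite mxE.
have [p [pg pJ]] := prime_nonzero_point iota gJ.
move: pg; rewrite !rmorphM !rmorph_prod !mulf_eq0 !negb_or -andbA.
case/and3P => pf /prodf_neq0 pPsi /prodf_neq0 py.
have onP : on_variety iota J (point_of p).
  split=> [i|h hJ]; last first.
    by rewrite meval_point_of pJ.
  apply: contraNneq (py i isT) => /rowP/(_ (b i)).
  by rewrite !mxE /= /xvar mmapX mmap1U => ->.
pose q : mpoint n L := fun j => evalv iota (fun c => repr (Psi j c 0)) (point_of p).
have qE j c : q j 0 c = mmap iota p (repr (Psi j c 0)).
  by rewrite mxE meval_point_of.
have valq j : value_at iota (Psi j) (point_of p) (q j).
  exists (fun c => repr (Psi j c 0)), 1; split; rewrite ?scale1r ?oner_neq0 //.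
    have -> : class_vector J (fun c => repr (Psi j c 0)) = Psi j.
      by apply/colP => c; rewrite mxE reprK.
    by split=> // c d; rewrite mulrC subrr.
  by apply: contraNneq (pPsi j isT) => /rowP/(_ (a j)); rewrite qE mxE /= => ->.
have [] := Psi_on (point_of p) q; [by split=> // j; exists (q j) | by [] |].
move=> _ /(_ f fI) q0; case/eqP: pf => /=.
rewrite -q0 meval_map_mpoly /substitute_lift rmorph_mmap.
apply: eq_mmap => [c|v] /=; first by rewrite mmapC.
by rewrite -qE.
Qed.

End Substitution.

(** * Birational maps *)

Section Birational.
Variables (A B : finType) (n : A -> nat) (m : B -> nat) (K : fieldType).
Variables (L : closedFieldType) (iota : {rmorphism K -> L}).
Variables (I : prime_idealr (mring K n)) (J : prime_idealr (mring K m)).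
Variables (Phi : multimap m I) (Psi : multimap n J).
Hypothesis hPhi : birational_with_inverse iota Phi Psi.

Local Notation QI := {ideal_quot I}.
Local Notation QJ := {ideal_quot J}.

Lemma substitute_Psi_ideal f : f \in I -> substitute Psi f = 0.
Proof.
case: hPhi => _ [Psi_rat _] _ idJ; apply: (substitute_ideal Psi_rat) => i.
by have [[]] := idJ i.
Qed.

Lemma substitute_Phi_ideal g : g \in J -> substitute Phi g = 0.
Proof.
case: hPhi => -[Phi_rat _] _ idI _; apply: (substitute_ideal Phi_rat) => j.
by have [[]] := idI j.
Qed.

Lemma substitute_Psi_eq f g : quot_proj I f = quot_proj I g ->
  substitute Psi f = substitute Psi g.
Proof.
move=> fg; apply/eqP; rewrite -subr_eq0 -rmorphB; apply/eqP/substitute_Psi_ideal.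
by rewrite -pi_eq0 rmorphB /= fg subrr.
Qed.

Lemma substitute_Phi_eq f g : quot_proj J f = quot_proj J g ->
  substitute Phi f = substitute Phi g.
Proof.
move=> fg; apply/eqP; rewrite -subr_eq0 -rmorphB; apply/eqP/substitute_Phi_ideal.
by rewrite -pi_eq0 rmorphB /= fg subrr.
Qed.

(** The composite with [Phi] being the identity of X means that substitution returns each block of
    variables up to one nonzero fraction. *)
Lemma compose_scale : exists2 c : A -> {fraction QI}, (forall j, c j != 0) &
  forall j (a : 'I_(n j).+1), tofrac (compose Phi (Psi j) a 0)
    = c j * tofrac (quot_proj I (xvar K a)).
Proof.
have ex j : exists c : {fraction QI}, c != 0 /\ forall a : 'I_(n j).+1,
    tofrac (compose Phi (Psi j) a 0) = c * tofrac (quot_proj I (xvar K a)).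
  have [_ _ /(_ j) + _] := hPhi; case=> -[id0 _] [comp0 _] prop.
  have [c c0 ec] := proportionalP id0 comp0 prop.
  by exists c; split=> // a; rewrite ec mxE.
by have [c hc] := choice ex; exists c => j; case: (hc j).
Qed.

(** Substituting [Phi] into a lift of [substitute Psi f] returns [f] times the nonzero fraction
    [\prod_j c j ^+ d j]. *)
Lemma substitute_form_inj d (f : mring K n) :
  multiform d f -> substitute Psi f = 0 -> f \in I.
Proof.
move=> df f0; have [c c0 ec] := compose_scale.
have e : tofrac (substitute Phi (substitute_lift Psi f))
    = (\prod_j c j ^+ d j) * tofrac (quot_proj I f).
  rewrite -pi_mpolyE /substitute_lift (rmorph_mmap (substitute Phi)) 2!rmorph_mmap -(multiform_mmap _ _ _ df).
  apply: eq_mmap => [a|v] /=; first by rewrite /substitute mmapC.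
  by have := ec _ (tagged (enum_val v)); rewrite /xvar mrank_tagged mxE.
have /substitute_Phi_ideal f0' : substitute_lift Psi f \in J.
  by rewrite -pi_eq0 pi_substitute_lift f0.
move/eqP: e; rewrite f0' rmorph0 eq_sym mulf_eq0 tofrac_eq0 pi_eq0 => /orP[|//].
rewrite prodf_seq_eq0 => /hasP[j _]; rewrite expf_eq0 (negPf (c0 j)).
by rewrite andbF.
Qed.

Section Representatives.
Variable F : forall i : B, 'I_(m i).+1 -> mring K n.
Arguments F : clear implicits.
Hypothesis hF : forall i, represents (Phi i) (class_vector I (F i)).

(** The hypothesis concerns the composite with [Phi]; it passes to any representative [F] because
    substituting [Psi] preserves proportionality modulo [I], provided [F] stays nonzero. *)
Lemma substitute_rep_scale : exists2 c : B -> {fraction QJ}, (forall i, c i != 0) &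
  forall i (a : 'I_(m i).+1), tofrac (substitute Psi (F i a))
    = c i * tofrac (quot_proj J (xvar K a)).
Proof.
have ex i : exists c : {fraction QJ}, c != 0 /\ forall a : 'I_(m i).+1,
    tofrac (substitute Psi (F i a)) = c * tofrac (quot_proj J (xvar K a)).
  have [_ _ _ /(_ i)] := hPhi; case=> -[id0 _] [comp0 _] prop.
  have [_ [F0 [d dF]] FF] := hF i.
  pose G := \col_a substitute Psi (F i a).
  have G0 : G != 0.
    have /cV_neq0P[a] := F0; rewrite mxE => Fa; apply/cV_neq0P; exists a.
    (* The entry of [F] is only a form modulo [I]; it is exchanged for a form of its class, to which
       [substitute_form_inj] applies. *)
    have [f df ef] := dF a; rewrite mxE in ef.
    rewrite mxE (substitute_Psi_eq ef); apply: contraNneq Fa => f0.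
    by rewrite ef pi_eq0 (substitute_form_inj df f0).
  have compG : proportional (compose Psi (Phi i)) G.
    move=> a b; rewrite !mxE -!rmorphM -rmorphB; apply: substitute_Psi_ideal.
    rewrite -pi_eq0 rmorphB !rmorphM /= /quot_proj /= !reprK.
    by have := FF a b; rewrite !mxE => ->.
  have [c c0 ec] := proportionalP id0 G0 (proportional_trans comp0 prop compG).
  by exists c; split=> // a; have := ec a; rewrite !mxE.
by have [c hc] := choice ex; exists c => i; case: (hc i).
Qed.

Lemma rep_scale : exists2 c : B -> {fraction QI}, (forall i, c i != 0) &
  forall i (a : 'I_(m i).+1), tofrac (quot_proj I (F i a)) = c i * tofrac (Phi i a 0).
Proof.
have ex i : exists c : {fraction QI}, c != 0 /\ forall a : 'I_(m i).+1,
    tofrac (quot_proj I (F i a)) = c * tofrac (Phi i a 0).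
  have [[Phi0 _] [F0 _] FF] := hF i.
  have [c c0 ec] := proportionalP Phi0 F0 FF.
  by exists c; split=> // a; have := ec a; rewrite mxE.
by have [c hc] := choice ex; exists c => i; case: (hc i).
Qed.

Definition rep_lift (g : mring K m) : mring K n :=
  mmap (@mpolyC _ K) (fun v => F _ (tagged (enum_val v))) g.

(** In the fraction field [P_a] evaluated at [F] is [x_a] times a factor independent of [a], namely
    [(\prod_i e i ^+ d i) * c j]. *)
Lemma inverse_relation (j : A) d (P : 'I_(n j).+1 -> mring K m) a b :
  (forall a, multiform d (P a)) -> class_vector J P = Psi j ->
  xvar K b * rep_lift (P a) - xvar K a * rep_lift (P b) \in I.
Proof.
move=> dP eP; have [c c0 ec] := compose_scale; have [e e0 ee] := rep_scale.
have PE a' : tofrac (quot_proj I (rep_lift (P a')))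
    = (\prod_i e i ^+ d i) * c j * tofrac (quot_proj I (xvar K a')).
  rewrite /rep_lift 2!rmorph_mmap.
  rewrite (@eq_mmap _ _ _ _ (@tofrac QI \o (quot_proj I \o @mpolyC _ K)) _
    (fun v => e (tag (enum_val v)) *
      tofrac (Phi (tag (enum_val v)) (tagged (enum_val v)) 0))) //; last first.
    by move=> v; apply: ee.
  rewrite (multiform_mmap _ _ _ (dP a')) -mulrA -ec mxE; congr (_ * _).
  rewrite -[RHS]/(tofrac (substitute Phi (repr (Psi j a' 0)))).
  rewrite (@substitute_Phi_eq _ (P a')) /substitute ?rmorph_mmap //.
  by rewrite /quot_proj /= reprK -eP mxE.
rewrite -pi_eq0 rmorphB !rmorphM /= -tofrac_eq0 tofracB !tofracM !PE.
by rewrite mulrCA [X in _ - X]mulrCA [X in _ - _ * X]mulrC subrr.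
Qed.

End Representatives.
End Birational.

(** * The graph ideal as a bigraded ideal *)

Lemma mcoeffM0 (k : nat) (R : nzRingType) (p q : {mpoly R[k]}) :
  (p * q)@_0%MM = p@_0%MM * q@_0%MM.
Proof. exact: rmorphM (mcoeff 0%MM) p q. Qed.

(** Leibniz rule: the coefficient of a variable is the constant term of the derivative. *)
Lemma mcoeffMU (k : nat) (R : comNzRingType) (p q : {mpoly R[k]}) i :
  (p * q)@_U_(i)%MM = p@_0%MM * q@_U_(i)%MM + p@_U_(i)%MM * q@_0%MM.
Proof.
have dE (h : {mpoly R[k]}) : h@_U_(i)%MM = (h^`M(i))@_0%MM.
  by rewrite mcoeff_deriv add0m mnm0E mulr1n.
by rewrite !dE mderivM mcoeffD !mcoeffM0 addrC.
Qed.

(** * Congruences modulo a generated ideal *)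

Section IdealGen.
Variables (R : comNzRingType) (G : R -> Prop).

Lemma ideal_gen_mem g : G g -> ideal_gen G g.
Proof.
by move=> Gg; exists 1%N, (fun=> 1), (fun=> g); rewrite big_ord1 mul1r.
Qed.

Lemma ideal_gen0 : ideal_gen G 0.
Proof. by exists 0%N, (fun=> 0), (fun=> 0); rewrite big_ord0; split=> // -[]. Qed.

Lemma ideal_genD f g : ideal_gen G f -> ideal_gen G g -> ideal_gen G (f + g).
Proof.
move=> [k [c [u [Gu ->]]]] [l [d [v [Gv ->]]]].
pose cat (w : 'I_k -> R) (w' : 'I_l -> R) (i : 'I_(k + l)) :=
  match split i with inl a => w a | inr b => w' b end.
exists (k + l)%N, (cat c d), (cat u v); split=> [i|].
  by rewrite /cat; case: split.
rewrite big_split_ord /=; congr (_ + _); apply: eq_bigr => i _; rewrite /cat.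
  by case: split_ordP => j /eqP; rewrite ?eq_lshift ?eq_lrshift // => /eqP ->.
by case: split_ordP => j /eqP; rewrite ?eq_rshift ?eq_rlshift // => /eqP ->.
Qed.

Lemma ideal_genMl a f : ideal_gen G f -> ideal_gen G (a * f).
Proof.
move=> [k [c [u [Gu ->]]]]; exists k, (fun i => a * c i), u; split=> //.
by rewrite mulr_sumr; apply: eq_bigr => i _; rewrite mulrA.
Qed.

Lemma ideal_gen_morph0 (S : comNzRingType) (phi : {rmorphism R -> S}) f :
  (forall g, G g -> phi g = 0) -> ideal_gen G f -> phi f = 0.
Proof.
move=> G0 [k [c [u [Gu ->]]]]; rewrite rmorph_sum big1 // => i _.
by rewrite rmorphM (G0 _ (Gu i)) mulr0.
Qed.

Lemma ideal_gen_trans a b c :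
  ideal_gen G (a - b) -> ideal_gen G (b - c) -> ideal_gen G (a - c).
Proof. by move=> ab bc; rewrite -[a](subrK b) -addrA; apply: ideal_genD. Qed.

Lemma ideal_genM_congr a b c d : ideal_gen G (a - b) -> ideal_gen G (c - d) ->
  ideal_gen G (a * c - b * d).
Proof.
move=> ab cd; apply: (@ideal_gen_trans _ (a * d)); rewrite -?mulrBr.
  exact: ideal_genMl.
by rewrite -mulrBl mulrC; apply: ideal_genMl.
Qed.

(** Serves to replace each [y] by [t F] modulo the ideal that defines the graph. *)
Lemma mmap_congr (k : nat) (K : nzRingType) (f : K -> R) (y z : 'I_k -> R)
    (p : {mpoly K[k]}) :
  (forall v, ideal_gen G (y v - z v)) -> ideal_gen G (mmap f y p - mmap f z p).
Proof.
move=> yz; rewrite /mmap.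
apply: (big_ind2 (fun a b => ideal_gen G (a - b))) => [|a b c d ab cd|u _].
- by rewrite subrr; apply: ideal_gen0.
- by rewrite opprD addrACA; apply: ideal_genD.
rewrite -mulrBr; apply: ideal_genMl; rewrite /mmap1.
apply: (big_ind2 (fun a b => ideal_gen G (a - b))) => [|a b c d ab cd|v _].
- by rewrite subrr; apply: ideal_gen0.
- exact: ideal_genM_congr.
elim: (u v) => [|e IH]; first by rewrite !expr0 subrr; apply: ideal_gen0.
by rewrite !exprS; apply: ideal_genM_congr.
Qed.

End IdealGen.

(** * Bidegrees and coefficients of polynomials in x over S *)

Section Bigraded.
Variables (r s : nat) (n : 'I_r -> nat) (m : 'I_s -> nat) (K : fieldType).
Local Notation T := (mring K (nm n m)).
Local Notation S := (mring K m).

Definition xpart (u : 'X_{1..#|{: mvar (nm n m)}|}) : 'X_{1..#|{: mvar n}|} :=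
  [multinom u (@mrank _ (nm n m) (inl (tag (enum_val v))) (tagged (enum_val v)))
    | v < #|{: mvar n}|].

Definition ypart (u : 'X_{1..#|{: mvar (nm n m)}|}) : 'X_{1..#|{: mvar m}|} :=
  [multinom u (@mrank _ (nm n m) (inr (tag (enum_val v))) (tagged (enum_val v)))
    | v < #|{: mvar m}|].

Lemma xpart_mrank u j (a : 'I_(n j).+1) :
  xpart u (mrank a) = u (@mrank _ (nm n m) (inl j) a).
Proof. by rewrite /xpart mnmE enum_val_mrank. Qed.

Lemma ypart_mrank u i (a : 'I_(m i).+1) :
  ypart u (mrank a) = u (@mrank _ (nm n m) (inr i) a).
Proof. by rewrite /ypart mnmE enum_val_mrank. Qed.

Lemma blockdeg_xpart u j : blockdeg (xpart u) j = blockdeg u (inl j).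
Proof. by apply: eq_bigr => a _; rewrite xpart_mrank. Qed.

Lemma blockdeg_ypart u i : blockdeg (ypart u) i = blockdeg u (inr i).
Proof. by apply: eq_bigr => a _; rewrite ypart_mrank. Qed.

Lemma as_xpolyXm (u : 'X_{1..#|{: mvar (nm n m)}|}) :
  as_xpoly ('X_[u] : T) = 'X_[xpart u] * ('X_[ypart u] : S)%:MP.
Proof.
rewrite /as_xpoly mmapX /mmap1 big_mvar big_sumType /=; congr (_ * _).
  rewrite mpolyXE_id big_mvar; apply: eq_bigr => j _; apply: eq_bigr => a _.
  by rewrite enum_val_mrank xpart_mrank.
rewrite mpolyXE_id rmorph_prod big_mvar; apply: eq_bigr => i _.
apply: eq_bigr => a _; rewrite enum_val_mrank ypart_mrank /=.
by rewrite rmorphXn.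
Qed.

Lemma mcoeff_as_xpoly (h : T) v w :
  (as_xpoly h)@_v@_w =
    \sum_(u <- msupp h | (xpart u == v) && (ypart u == w)) h@_u.
Proof.
rewrite {1}[h]mpolyE /as_xpoly rmorph_sum /= !raddf_sum /= [RHS]big_mkcond.
apply: eq_bigr => u _; rewrite mmapZ -/(as_xpoly _) as_xpolyXm /=.
rewrite mulrCA -!rmorphM /= mulrC mcoeffCM mcoeffX mulrC.
case: eqP => [_|_] /=; last by rewrite mul0r mcoeff0.
rewrite mul1r mcoeffCM mcoeffX; case: eqP => _; rewrite ?mulr1 ?mulr0 //.
Qed.

Lemma as_xpoly_support (h : T) v w : (as_xpoly h)@_v@_w != 0 ->
  exists2 u, u \in msupp h & (forall j, blockdeg v j = blockdeg u (inl j)) /\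
    (forall i, blockdeg w i = blockdeg u (inr i)).
Proof.
rewrite mcoeff_as_xpoly => h0.
have /hasP[u uh /andP[/eqP <- /eqP <-]] :
    has (fun u => (xpart u == v) && (ypart u == w)) (msupp h).
  apply: contraNT h0 => /hasPn no; rewrite big_seq_cond big1 // => u /andP[uh].
  by move=> e; have := no u uh; rewrite e.
by exists u => //; split=> k; rewrite ?blockdeg_xpart ?blockdeg_ypart.
Qed.

Lemma as_xpoly_coef_support (h : T) v : (as_xpoly h)@_v != 0 ->
  exists2 u, u \in msupp h & forall j, blockdeg v j = blockdeg u (inl j).
Proof.
move=> h0; have [w hw] : exists w, (as_xpoly h)@_v@_w != 0.
  apply/not_existsP => no; case/eqP: h0; apply/mpolyP => w; rewrite mcoeff0.
  by apply/eqP/negP => /negP; apply: no.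
by have [u uh [xu _]] := as_xpoly_support hw; exists u.
Qed.

Lemma multiform_as_xpoly D (h : T) v :
  multiform D h -> multiform (fun i => D (inr i)) (as_xpoly h)@_v.
Proof.
move=> Dh; apply/multiformP => w /as_xpoly_support[u uh [_ yu]] i.
by rewrite yu Dh.
Qed.

(** A nonzero coefficient exhibits one monomial of x-degree 1 in block [j] and 0 elsewhere; in a
    form all monomials then share this x-degree. *)
Lemma xcoef_not_xlinear D (j : 'I_r) (a : 'I_(n j).+1) (h : T) :
  multiform D h -> ~~ xlinear j h -> xcoef a h = 0.
Proof.
move=> Dh; apply: contraNeq => /as_xpoly_coef_support[u uh xu].
apply/allP => w wh; apply/forallP => k.
by rewrite (Dh _ wh) -(Dh _ uh) -xu blockdegU.
Qed.

Lemma xcoef_big (j : 'I_r) (a : 'I_(n j).+1) k (f : 'I_k -> T) :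
  xcoef a (\sum_i f i) = \sum_i xcoef a (f i).
Proof. by rewrite /xcoef as_xpoly_sum; apply: (raddf_sum (mcoeff _)). Qed.

Lemma xcoef_mul (j : 'I_r) (a : 'I_(n j).+1) (c h : T) :
  xcoef a (c * h) = (as_xpoly c)@_0%MM * xcoef a h + xcoef a c * (as_xpoly h)@_0%MM.
Proof. by rewrite /xcoef as_xpolyM mcoeffMU. Qed.

Lemma as_xpoly_const D (h : T) : multiform D h -> (as_xpoly h)@_0%MM != 0 ->
  as_xpoly h = ((as_xpoly h)@_0%MM)%:MP.
Proof.
move=> Dh h0; apply/mpolyP => v; rewrite mcoeffC.
have [<-|v0] := eqVneq 0%MM v; first by rewrite mulr1.
rewrite mulr0; apply/eqP; apply: contraNT v0.
move=> /as_xpoly_coef_support[u uh xu]; have [u' u'h xu'] := as_xpoly_coef_support h0.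
rewrite eq_sym -mdeg_eq0 mdeg_blockdeg big1 // => j _.
rewrite xu (Dh _ uh) -(Dh _ u'h) -xu'.
by rewrite /blockdeg big1 // => a _; rewrite mnm0E.
Qed.

Lemma as_xpoly_xlinear (j : 'I_r) (h : T) : xlinear j h ->
  as_xpoly h = \sum_(a < (n j).+1) (xcoef a h)%:MP * 'X_(mrank a).
Proof.
move=> /allP xh; apply/mpolyP => v; rewrite [RHS]raddf_sum /=.
rewrite (eq_bigr (fun a => xcoef a h * (U_(mrank a)%MM == v)%:R)); last first.
  by move=> a _; rewrite mcoeffCM mcoeffX.
have [v0|v0] := eqVneq (as_xpoly h)@_v 0.
  rewrite v0 big1 // => a _; case: eqP => [e|_]; last by rewrite mulr0.
  by rewrite mulr1 /xcoef e v0.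
have [u uh xu] := as_xpoly_coef_support v0.
have [k|a va] := @blockdeg_delta _ n v j.
  by rewrite xu; have /forallP/(_ k)/eqP := xh u uh.
subst v; rewrite (bigD1 a) //= eqxx mulr1 big1 ?addr0 // => b ba.
case: eqP => [e|]; rewrite ?mulr0 //; case/eqP: ba.
have /mnmP/(_ (mrank b)) := e; rewrite !mnm1E eqxx.
by case: eqP => // /enum_rank_inj/eqP; rewrite eq_Tagged => /eqP /=.
Qed.

End Bigraded.

(** * The matrix of a birational map *)

Lemma relation_rearrange (R : comNzRingType) (X xa xb ya yb fa fb : R) :
  xb * (ya - X * fa) + - xa * (yb - X * fb) + X * (xb * fa - xa * fb)
    = xb * ya - xa * yb.
Proof.
rewrite !mulrBr !mulNr opprK [xb * (X * fa)]mulrCA [xa * (X * fb)]mulrCA.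
set q := X * (xb * fa); set w := X * (xa * fb).
by rewrite -addrA [q - w]addrC [_ + (- w + q)]addrA addrK [_ + q]addrC addrA subrK.
Qed.

Lemma quot_projMD (R : comNzRingType) (I : idealr R) (x y z t : R) :
  quot_proj I t = 0 -> quot_proj I (x * y + z * t) = quot_proj I x * quot_proj I y.
Proof. by move=> t0; rewrite rmorphD !rmorphM /= [\pi t]t0 mulr0 addr0. Qed.

Section GraphOfBirational.
Variables (r s : nat) (n : 'I_r -> nat) (m : 'I_s -> nat) (K : fieldType).
Variables (L : closedFieldType) (iota : {rmorphism K -> L}).
Variables (I : prime_idealr (mring K n)) (J : prime_idealr (mring K m)).
Variables (Phi : multimap m I) (Psi : multimap n J).
Hypothesis hPhi : birational_with_inverse iota Phi Psi.
Variable F : forall i : 'I_s, 'I_(m i).+1 -> mring K n.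
Arguments F : clear implicits.
Hypothesis hF : forall i, represents (Phi i) (class_vector I (F i)).

Local Notation T := (mring K (nm n m)).
Local Notation QJ := {ideal_quot J}.

(** The parametrisation of the graph by Y: [x] goes to [Psi], and [y] to its own class. *)
Definition inverse_coord (v : 'I_#|{: mvar (nm n m)}|) : QJ :=
  match enum_val v with
  | existT (inl j) a => Psi j a 0
  | existT (inr i) a => quot_proj J (@xvar _ m K i a)
  end.

Definition eval_inverse : {rmorphism T -> QJ} :=
  mmap (quot_proj J \o @mpolyC _ K) inverse_coord.

Lemma eval_inverse_Tx j (a : 'I_(n j).+1) : eval_inverse (Tx m K a) = Psi j a 0.
Proof. by rewrite /= /Tx /xvar mmapX mmap1U /inverse_coord enum_val_mrank. Qed.

Lemma eval_inverse_Ty i (a : 'I_(m i).+1) :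
  eval_inverse (Ty n K a) = quot_proj J (xvar K a).
Proof. by rewrite /= /Ty /xvar mmapX mmap1U /inverse_coord enum_val_mrank. Qed.

Lemma eval_inverse_Tembx f : eval_inverse (Tembx m f) = substitute Psi f.
Proof.
rewrite /Tembx rmorph_mmap; apply: eq_mmap => [c|v]; first by rewrite /= mmapC.
exact: eval_inverse_Tx.
Qed.

(** With [t_i] sent to the inverse of the factor in [substitute_rep_scale], the evaluation extends
    to [theta], which kills the generators. *)
Lemma eval_inverse_graph h : graph_ideal I F h -> eval_inverse h = 0.
Proof.
have [c c0 ec] := substitute_rep_scale hPhi hF.
pose theta : {rmorphism {mpoly T[s]} -> {fraction QJ}} :=
  mmap (@tofrac QJ \o eval_inverse) (fun i => (c i)^-1).
move=> hh; apply/eqP; rewrite -tofrac_eq0; apply/eqP.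
have <- : theta h%:MP = tofrac (eval_inverse h) by rewrite /= mmapC.
apply: ideal_gen_morph0 hh => _ [[f fI ->]|[i [a ->]]].
  rewrite /= mmapC /= -/(eval_inverse _) eval_inverse_Tembx.
  by rewrite (substitute_Psi_ideal hPhi fI) tofrac0.
rewrite rmorphB rmorphM /= !mmapC mmapX mmap1U /=.
rewrite -!/(eval_inverse _) eval_inverse_Ty eval_inverse_Tembx ec.
by rewrite mulKf // subrr.
Qed.

Lemma eval_inverse_as_xpoly h : eval_inverse h =
  mmap (quot_proj J) (fun v => Psi (tag (enum_val v)) (tagged (enum_val v)) 0)
    (as_xpoly h).
Proof.
rewrite /as_xpoly mmap_mmap; apply: eq_mmap => [c|v] /=.
  by rewrite mmapC.
rewrite /inverse_coord; case: (enum_val v) => -[j|i] a /=.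
  by rewrite /xvar mmapX mmap1U enum_val_mrank.
by rewrite mmapC.
Qed.

(** A form with a nonzero term free of x has x-degree 0, so [eval_inverse] returns the class of that
    term. *)
Lemma graph_const D h : multiform D h -> graph_ideal I F h ->
  (as_xpoly h)@_0%MM \in J.
Proof.
move=> Dh /eval_inverse_graph e; have [->|h0] := eqVneq (as_xpoly h)@_0%MM 0.
  exact: rpred0.
rewrite -pi_eq0; move/eqP: e; rewrite eval_inverse_as_xpoly.
by rewrite (as_xpoly_const Dh h0) mmapC mcoeffC eqxx mulr1.
Qed.

Lemma graph_xlinear (j : 'I_r) h : xlinear j h -> graph_ideal I F h ->
  \sum_(a < (n j).+1) quot_proj J (xcoef a h) * Psi j a 0 = 0.
Proof.
move=> xh /eval_inverse_graph e; rewrite -[RHS]e eval_inverse_as_xpoly.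
rewrite (as_xpoly_xlinear xh) rmorph_sum; apply: eq_bigr => a _.
by rewrite rmorphM /= mmapC mmapX mmap1U enum_val_mrank.
Qed.

(** Modulo the generators [y] equals [t F], and homogeneity takes the powers of [t] out of [g]. *)
Lemma graph_Temby d (g : mring K m) : multiform d g ->
  ideal_gen (graph_gens I F) ((Temby n g)%:MP -
    (\prod_i ('X_i : {mpoly T[s]}) ^+ d i) * (Tembx m (rep_lift F g))%:MP).
Proof.
move=> dg.
have -> : (Temby n g)%:MP = mmap (@mpolyC s T \o @mpolyC _ K)
    (fun v => (Ty n K (tagged (enum_val v)))%:MP) g :> {mpoly T[s]}.
  exact: rmorph_mmap.
have -> : (\prod_i ('X_i : {mpoly T[s]}) ^+ d i) * (Tembx m (rep_lift F g))%:MP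
    = mmap (@mpolyC s T \o @mpolyC _ K) (fun v => 'X_(tag (enum_val v)) *
        (Tembx m (F _ (tagged (enum_val v))))%:MP) g.
  rewrite (multiform_mmap _ _ (fun i => 'X_i : {mpoly T[s]}) dg); congr (_ * _).
  rewrite /rep_lift [Tembx _ _]rmorph_mmap rmorph_mmap; apply: eq_mmap => c //=.
  by rewrite mmapC.
apply: mmap_congr => v; apply: ideal_gen_mem; right.
by exists (tag (enum_val v)), (tagged (enum_val v)).
Qed.

Lemma graph_relation (j : 'I_r) d (P : 'I_(n j).+1 -> mring K m) a b :
  (forall a, multiform d (P a)) -> class_vector J P = Psi j ->
  graph_ideal I F (Tx m K b * Temby n (P a) - Tx m K a * Temby n (P b)).
Proof.
move=> dP eP; have rel := inverse_relation hPhi hF a b dP eP.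
rewrite /graph_ideal rmorphB !rmorphM /=.
have ga := ideal_genMl (Tx m K b)%:MP (graph_Temby (dP a)).
have gb := ideal_genMl (- (Tx m K a)%:MP) (graph_Temby (dP b)).
have gc : ideal_gen (graph_gens I F)
    (Tembx m (xvar K b * rep_lift F (P a) - xvar K a * rep_lift F (P b)))%:MP.
  by apply: ideal_gen_mem; left; eexists; first exact: rel.
(* The multiple of [gc] cancels the terms of [ga] and [gb] that contain [t]. *)
have := ideal_genD (ideal_genD ga gb)
  (ideal_genMl (\prod_i ('X_i : {mpoly T[s]}) ^+ d i) gc).
congr ideal_gen.
have eT c : Tembx m (xvar K c) = Tx m K (c : 'I_(n j).+1).
  by rewrite /Tembx {1}/xvar mmapX mmap1U enum_val_mrank.
rewrite {3}/Tembx !rmorphB !rmorphM /= -!/(Tembx m _) !eT.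
exact: relation_rearrange.
Qed.

Variable gs : seq T.
Hypothesis gs_form : forall h, h \in gs -> exists d, multiform d h.
Hypothesis gs_gen : generates (graph_ideal I F) gs.

Lemma graph_mem h : h \in gs -> graph_ideal I F h.
Proof. by move=> hg; apply/gs_gen/ideal_gen_mem. Qed.

Lemma Jmatrix_Psi (j : 'I_r) : Jmatrix J gs j *m Psi j = 0.
Proof.
apply/colP => k; rewrite [LHS]mxE [RHS]mxE.
set h := (xlinear_gens gs j)`_k.
have : h \in xlinear_gens gs j by apply: mem_nth.
rewrite mem_filter => /andP[xh hg]; rewrite -[RHS](graph_xlinear xh (graph_mem hg)).
by apply: eq_bigr => a _; rewrite mxE.
Qed.

(** Expanding [h] on [gs], a generator contributes modulo [J] only a multiple of its own coefficient
    row, which is a row of the matrix if the generator is linear in block [j] and zero otherwise. *)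
Lemma Jmatrix_span (j : 'I_r) h : graph_ideal I F h ->
  exists c : 'rV[QJ]_(size (xlinear_gens gs j)),
    c *m Jmatrix J gs j = \row_a quot_proj J (xcoef a h).
Proof.
move=> /gs_gen[k [c [g [gg ->]]]].
pose spanned (w : 'rV[QJ]_(n j).+1) := exists c, c *m Jmatrix J gs j = w.
have spannedD w w' : spanned w -> spanned w' -> spanned (w + w').
  by move=> [u <-] [u' <-]; exists (u + u'); rewrite mulmxDl.
have spanned0 : spanned 0 by exists 0; rewrite mul0mx.
have -> : \row_a quot_proj J (xcoef (j := j) a (\sum_i c i * g i))
    = \sum_i \row_a quot_proj J (xcoef (j := j) a (c i * g i)).
  apply/rowP => a; rewrite mxE xcoef_big summxE [LHS](rmorph_sum (quot_proj J)).
  by apply: eq_bigr => i _; rewrite mxE.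
apply: (big_ind spanned) => // i _.
have [D Dg] := gs_form (gg i).
(* By the product rule [y] is the class of the x-free term of [c i], the same for every [a]; the
   other summand contains the x-free term of [g i], which is in [J]. *)
have [y e] : exists y, forall a, quot_proj J (xcoef a (c i * g i))
    = y * quot_proj J (xcoef (j := j) a (g i)).
  have /eqP g0 : quot_proj J (as_xpoly (g i))@_0%MM == 0.
    by rewrite pi_eq0; apply: graph_const Dg (graph_mem (gg i)).
  by eexists => a; rewrite xcoef_mul; apply: quot_projMD.
have [xg|xg] := boolP (xlinear j (g i)); last first.
  suff -> : \row_a quot_proj J (xcoef (j := j) a (c i * g i)) = 0 by [].
  by apply/rowP => a; rewrite mxE e (xcoef_not_xlinear _ Dg xg) rmorph0 mulr0 mxE.
have gx : g i \in xlinear_gens gs j by rewrite mem_filter xg gg.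
have ix : (index (g i) (xlinear_gens gs j) < size (xlinear_gens gs j))%N.
  by rewrite index_mem.
have rowg : row (Ordinal ix) (Jmatrix J gs j) = \row_a quot_proj J (xcoef a (g i)).
  by apply/rowP => a; rewrite [LHS]mxE [LHS]mxE [RHS]mxE nth_index.
exists (y *: delta_mx 0 (Ordinal ix)).
rewrite -scalemxAl -rowE rowg; apply/rowP => a; rewrite [RHS]mxE.
by apply: etrans (esym (e a)); rewrite [LHS]mxE [X in _ * X]mxE.
Qed.

End GraphOfBirational.

(** * Homogeneous vectors *)

Section HomogeneousVectors.
Variables (A : finType) (n : A -> nat) (K : fieldType) (I : idealr (mring K n)).
Local Notation Q := {ideal_quot I}.

Lemma homog_vector_lift k (v : 'cV[Q]_k) : homog_vector v ->
  exists d (f : 'I_k -> mring K n), (forall a, multiform d (f a)) /\ class_vector I f = v.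
Proof.
move=> [d dv].
have [f fP] := choice (fun a => let: ex_intro2 f df ef := dv a in
  ex_intro (fun f => multiform d f /\ v a 0 = quot_proj I f) f (conj df ef)).
exists d, f; split=> [a|]; first by case: (fP a).
by apply/colP => a; rewrite mxE; case: (fP a).
Qed.

Lemma qform0 d : qform d (0 : Q).
Proof.
by exists 0; [apply: multiform0 | rewrite -[RHS]/(quot_proj I 0) rmorph0].
Qed.

Lemma qformD d (x y : Q) : qform d x -> qform d y -> qform d (x + y).
Proof.
move=> [f df ->] [g dg ->]; exists (f + g); first exact: multiformD.
exact: esym (rmorphD (quot_proj I) f g).
Qed.

Lemma qformM d e (x y : Q) :
  qform d x -> qform e y -> qform (fun j => d j + e j)%N (x * y).
Proof.
move=> [f df ->] [g dg ->]; exists (f * g); first exact: multiformM.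
exact: esym (rmorphM (quot_proj I) f g).
Qed.

Lemma qform_sign d (b : bool) (x : Q) : qform d x -> qform d ((-1) ^+ b * x).
Proof.
move=> [f df ->]; exists ((-1) ^+ b * f); first exact: multiform_sign.
by rewrite -[RHS]/(quot_proj I _) rmorphM rmorph_sign.
Qed.

Lemma qform_prod k (d : 'I_k -> A -> nat) (x : 'I_k -> Q) :
  (forall i, qform (d i) (x i)) -> qform (fun j => \sum_i d i j)%N (\prod_i x i).
Proof.
elim: k d x => [|k IH] d x dx.
  exists 1; last by rewrite big_ord0 -[RHS]/(quot_proj I 1) rmorph1.
  have -> : (fun j => \sum_(i < 0) d i j)%N = fun=> 0%N.
    by apply: funext => j; rewrite big_ord0.
  exact: multiform1.
rewrite big_ord_recl.
have -> : (fun j => \sum_i d i j)%N =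
    (fun j => d ord0 j + \sum_(i < k) d (lift ord0 i) j)%N.
  by apply: funext => j; rewrite big_ord_recl.
by apply: qformM => //; apply: (IH (fun i => d (lift ord0 i))).
Qed.

(** Each term of the Leibniz formula takes one entry from every row, so degrees may vary from row to
    row. *)
Lemma qform_det k (d : 'I_k -> A -> nat) (M : 'M[Q]_k) :
  (forall i b, qform (d i) (M i b)) -> qform (fun j => \sum_i d i j)%N (\det M).
Proof.
move=> dM; apply: (big_ind (qform _)) => [|x y|p _].
- exact: qform0.
- exact: qformD.
by apply: qform_sign; apply: qform_prod.
Qed.

Lemma homog_signed_minors k (d : 'I_k -> A -> nat) (N : 'M[Q]_(k, k.+1)) :
  (forall i a, qform (d i) (N i a)) -> homog_vector (signed_minors N).
Proof.
move=> dN; exists (fun j => \sum_i d i j)%N => a; rewrite mxE -signr_odd.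
by apply/qform_sign/qform_det => i b; rewrite mxE.
Qed.

(** All entries of [p] have degree [d], so the relations between [p] and [v] split into relations
    between [p] and the components of [v], each in the homogeneous ideal [I]. *)
Lemma proportional_components k d (p : 'I_k -> mring K n) (v : 'cV[Q]_k) :
  homogeneous_ideal I -> (forall a, multiform d (p a)) ->
  proportional (class_vector I p) v ->
  exists (l : nat) (w : 'I_l -> 'cV[Q]_k),
    (forall i, proportional (class_vector I p) (w i) /\ homog_vector (w i)) /\
    v = \sum_(i < l) w i.
Proof.
move=> hI dp pv; pose f a := repr (v a 0).
have fv a : quot_proj I (f a) = v a 0 by rewrite /quot_proj /= reprK.
(* One list of degrees for all entries, so that each component is a vector of a single degree. *)
pose s := undup (flatten [seq degrees (f a) | a <- enum 'I_k]).
pose w (i : 'I_(size s)) : 'cV[Q]_k :=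
  class_vector I (fun a => component (tnth (in_tuple s) i) (f a)).
exists (size s), w; split=> [i|]; last first.
  apply/colP => a; rewrite summxE -fv.
  rewrite {1}[f a](@component_sum _ _ _ s) ?undup_uniq //; last first.
    move=> d' d'f; rewrite mem_undup; apply/flattenP; exists (degrees (f a)) => //.
    by apply/mapP; exists a; rewrite ?mem_enum.
  rewrite [LHS](rmorph_sum (quot_proj I)) big_tnth; apply: eq_bigr => i _.
  by rewrite mxE.
split; last first.
  exists (tnth (in_tuple s) i) => a.
  exists (component (tnth (in_tuple s) i) (f a)); last by rewrite mxE.
  exact: multiform_component.
move=> a b; rewrite !mxE; set e := tnth _ i.
rewrite -[LHS]/(quot_proj I (p a) * quot_proj I (component e (f b)) -
  quot_proj I (p b) * quot_proj I (component e (f a))).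
rewrite -!rmorphM -rmorphB; apply/eqP; rewrite pi_eq0 mulrC [p b * _]mulrC.
rewrite -!(component_mulr _ _ (dp _)) -raddfB component_ideal //.
have := pv a b; rewrite !mxE -!fv => e0; rewrite -pi_eq0 -[X in _ == X]e0.
by rewrite rmorphB !rmorphM /= ![quot_proj I (f _) * _]mulrC.
Qed.

End HomogeneousVectors.

(** * The kernel as the module of representatives of the inverse *)

Lemma xcoefB (r s : nat) (n : 'I_r -> nat) (m : 'I_s -> nat) (K : fieldType)
    (j : 'I_r) (a : 'I_(n j).+1) (f g : mring K (nm n m)) :
  xcoef a (f - g) = xcoef a f - xcoef a g.
Proof. by rewrite /xcoef /as_xpoly mmapB mcoeffB. Qed.

Lemma xcoef_TxTemby (r s : nat) (n : 'I_r -> nat) (m : 'I_s -> nat) (K : fieldType)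
    (j : 'I_r) (a b : 'I_(n j).+1) (g : mring K m) :
  xcoef a (Tx m K b * Temby n g) = g * (a == b)%:R.
Proof.
rewrite /xcoef as_xpolyM as_xpolyX as_xpoly_Temby mulrC mcoeffCM mcoeffX.
congr (_ * _%:R); congr nat_of_bool; apply/eqP/eqP => [/mnmP/(_ (mrank a))|-> //].
rewrite !mnm1E eqxx; case: eqP => // /enum_rank_inj/eqP.
by rewrite eq_Tagged => /eqP /=.
Qed.

Theorem proposition1p4
    (K : fieldType)
    (Kbar : closedFieldType) (iota : {rmorphism K -> Kbar})
    (Kbar_alg : forall z : Kbar, algebraicOver iota z)
    (r s : nat) (r_gt0 : (0 < r)%N) (s_gt0 : (0 < s)%N)
    (n : 'I_r -> nat) (m : 'I_s -> nat)
    (I : prime_idealr (mring K n)) (J : prime_idealr (mring K m))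
    (hI : multiprojective_ideal iota I) (hJ : multiprojective_ideal iota J)
    (Phi : multimap m I) (Psi : multimap n J)
    (hPhi : birational_with_inverse iota Phi Psi)
    (F : forall i : 'I_s, 'I_(m i).+1 -> mring K n)
    (hF : forall i, represents (Phi i) (class_vector I (F i)))
    (gs : seq (mring K (nm n m)))
    (hgs : minimal_form_generators (graph_ideal I F) gs)
    (j : 'I_r) :
  [/\ is_rep_module (Psi j) (fun v => Jmatrix J gs j *m v = 0),
      frac_rank (Jmatrix J gs j) = n j &
      forall rows : 'I_(n j) -> 'I_(size (xlinear_gens gs j)),
        {homo rows : k l / (k < l)%N} ->
        frac_rank (rowsub rows (Jmatrix J gs j)) = n j ->
        represents (Psi j) (signed_minors (rowsub rows (Jmatrix J gs j)))].
Proof.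
have [_ gs_form gs_gen _] := hgs.
have [_ [[Psi_form _] _] _ _] := hPhi.
have Psij := Psi_form j; have [Psi0 Psi_homog] := Psij.
have [d [p [dp ep]]] := homog_vector_lift Psi_homog.
have MP := Jmatrix_Psi hPhi hF gs_gen j.
(* The coefficient row of [x_b P_a - x_a P_b], an element of the graph ideal, is
   [P_a e_b - P_b e_a]. *)
have span a b : exists c : 'rV_(size (xlinear_gens gs j)), c *m Jmatrix J gs j =
    Psi j a 0 *: delta_mx 0 b - Psi j b 0 *: delta_mx 0 a.
  have [c ec] := Jmatrix_span hPhi hF gs_form gs_gen j (graph_relation hPhi hF a b dp ep).
  exists c; rewrite ec -ep; apply/rowP => e.
  rewrite mxE xcoefB !xcoef_TxTemby [LHS](rmorphB (quot_proj J)).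
  by rewrite !(rmorphM (quot_proj J)) !(rmorph_nat (quot_proj J)) !mxE.
have kerE := line_kernelE Psi0 MP span.
split; last 2 first.
- by have := frac_rank_line_kernel Psi0 MP span.
- move=> rows _ rk; have NP : rowsub rows (Jmatrix J gs j) *m Psi j = 0.
    by rewrite mul_rowsub_mx MP; apply/matrixP => a b; rewrite !mxE.
  have [N0 PN] := proportional_signed_minors Psi0 NP rk.
  split=> //; split=> //.
  (* It remains to see that the minors are forms of one degree: the entries of a row all have the
     y-degree of its generator. *)
  have gD (k : 'I_(size (xlinear_gens gs j))) :
      exists D, multiform D (xlinear_gens gs j)`_k.
    by apply: gs_form; have := mem_nth 0 (ltn_ord k); rewrite mem_filter => /andP[].
  have [D DP] := choice gD.
  apply: (@homog_signed_minors _ _ _ _ _ (fun k i => D (rows k) (inr i))) => k a.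
  exists (xcoef a (xlinear_gens gs j)`_(rows k)); last by rewrite !mxE.
  exact: multiform_as_xpoly.
split=> [|c v w Mv Mw|v /kerE|v vf].
- by rewrite mulmx0.
- by rewrite mulmxDr -scalemxAr Mv Mw scaler0 addr0.
- have [hJ0 _ _] := hJ.
  (* The kernel is graded because proportionality to the form vector [p] passes to homogeneous
     components. *)
  rewrite -ep => /(proportional_components hJ0 dp)[l [w [wP ->]]].
  exists l, w; split=> // i; have [pw hw] := wP i; split=> //.
  by apply/kerE; rewrite -ep.
- by split=> [/kerE Pv|[_ _ Pv]]; [split|apply/kerE].
Qed.
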